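(* Let $d\ge 2$, $q\ge 2$, and let $\mathbb{P}$ be a translation-invariant probability measure on $\Omega=\{0,1,\dots,q-1\}^{\mathbb{Z}^d}$ which has the boundary-$1$ Markov property, the finite-energy property, and a cluster-size distribution with an exponential tail with limit $\mu\in(0,1]$. Let $r\ge1$ be an integer, let $P$ and $P'$ be two distinct patterns of diameter $r$, and let $$\gamma=\gamma_{PP'}=\frac{\mu^{c_{P'}}\,\mathbb{P}(\Box P)}{\mu^{c_P}\,\mathbb{P}(\Box P')}.$$ Then the following statements hold: (i) If $c_P=c_{P'}$, then for all $\alpha>\tfrac12$ and for every $\epsilon>0$, $$\limsup_{n\to\infty}\big[\mathbb{P}_n(|N_P-\gamma N_{P'}|\ge\epsilon n^\alpha)\big]^{1/n^{2\alpha-1}}<1.$$ (ii) If the cluster-size distribution has a stretched exponential tail with exponent $\beta\in(0,1)$, then for every $\alpha\ge\tfrac12(1+\beta)$ and every $\epsilon>0$, $$\limsup_{n\to\infty}\big[\mathbb{P}_n(N_P\ge\gamma N_{P'}+\epsilon n^\alpha)\big]^{1/n^{2\alpha-1}}<1.$$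
   Context: Setting: $S=\{0,1,\dots,q-1\}$, $\Omega=S^{\mathbb{Z}^d}$; for $V\subset\mathbb{Z}^d$, $\omega_V$ is the restriction of $\omega\in\Omega$ to $V$. Finite-energy property: there exists $h\in(0,1)$ such that for all $s\in S$, $h\le\inf_{\sigma\in\Omega}\mathbb{P}(\omega(x)=s\mid\omega_{\mathbb{Z}^d\setminus\{x\}}=\sigma_{\mathbb{Z}^d\setminus\{x\}})\le\sup_{\sigma\in\Omega}\mathbb{P}(\omega(x)=s\mid\omega_{\mathbb{Z}^d\setminus\{x\}}=\sigma_{\mathbb{Z}^d\setminus\{x\}})\le 1-h$ (by translation invariance the site $x$ is irrelevant). Boundary-$s$ Markov property ($s\in S$): for finite $V\subset\mathbb{Z}^d$ let $N_V=\bigcup_{x\in V}(N_x\setminus V)$, where $N_x=\{y\in\mathbb{Z}^d:|y-x|=1\}$. $\mathbb{P}$ has the boundary-$s$ Markov property if for every finite $V\subset\mathbb{Z}^d$, given that all sites of $N_V$ are in the state $s$, the configuration on $V$ is conditionally independent of the configuration on $\mathbb{Z}^d\setminus(V\cup N_V)$. Clusters: a site $x$ is occupied if $\omega(x)=1$. $C(x)$ is the set of occupied sites that can be connected to $x$ by a nearest-neighbour path in $\mathbb{Z}^d$ passing only through occupied sites; $C(x)=\varnothing$ if $\omega(x)\ne 1$. $C=C(0)$, and $|X|$ is the number of sites of $X$. Exponential tail: the limit $\mu=\lim_{n\to\infty}[\mathbb{P}(|C|=n)]^{1/n}=\lim_{n\to\infty}[\mathbb{P}(n\le|C|<\infty)]^{1/n}$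 exists for some $0<\mu\le 1$ (both limits exist and are equal). Stretched exponential tail with exponent $\beta\in(0,1)$: the limit $\nu=\lim_{n\to\infty}[\mathbb{P}(|C|=n)]^{1/n^\beta}=\lim_{n\to\infty}[\mathbb{P}(n\le|C|<\infty)]^{1/n^\beta}$ exists for some $0<\nu<1$ (both limits exist and are equal). Conditional measure: $\mathbb{P}_n(\cdot)=\mathbb{P}(\cdot\mid |C|=n)$. Patterns: $Q=\{x\in\mathbb{Z}^d:0\le x_i<r\ \forall i\}$, $\overline{Q}=\{x\in\mathbb{Z}^d:-1\le x_i<r+1\ \forall i\}$, $\partial Q=\overline{Q}\setminus Q$, $Q_x=x+Q$, $\partial Q_x=x+\partial Q$. A pattern of diameter $r$ is an element $P=(P(x):x\in Q)$ of $S^Q$. $P$ occurs at $x$ if $\omega(x+y)=P(y)$ for all $y\in Q$; $P$ occurs at $x$ on $C$ if moreover $\partial Q_x\subset C$. $N_P=N_P(\omega)$ is the number of sites $x$ of the grid $(r+2)\mathbb{Z}^d+(1,1,\dots,1)$ such that $P$ occurs at $x$ on $C$. $c_P$ is the number of occupied sites in the pattern $P$ which are part of the cluster of the origin whenever $P$ occurs on $C$ at some site, i.e. the number of $y\in Q$ with $P(y)=1$ that are connected to $\partial Q$ by a nearest-neighbour path whose sites in $Q$ are all in state $1$ under $P$. $\mathbb{P}(\Box P)=\mathbb{P}(\omega(x)=P(x)\ \forall x\in Q,\ \omega(x)=1\ \forall x\in\partial Q)$. *)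

(* Defs.v *)
From HB Require Import structures.
From mathcomp Require Import all_boot all_order all_algebra.

From mathcomp Require Import finmap.
From mathcomp Require Import all_classical all_reals all_analysis.

Set Implicit Arguments.
Unset Strict Implicit.
Unset Printing Implicit Defensive.

Import Order.TTheory GRing.Theory Num.Theory.
Import numFieldNormedType.Exports.

Local Open Scope classical_set_scope.
Local Open Scope ring_scope.

Notation lattice d := 'rV[int]_d.

(* The state space {0, ..., q-1}, for q >= 1; the successor form makes the
   type inhabited, as required by measurableType. *)
Definition spin (q : nat) : Type := 'I_q.-1.+1.

HB.instance Definition _ q := Finite.on (spin q).
HB.instance Definition _ q := isPointed.Build (spin q) ord0.

(* For q >= 2 this is the state 1. *)
Definition spin1 (q : nat) : spin q := inord 1.

Definition cylinders (d q : nat) (V : set (lattice d)) :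
    set (set (lattice d -> spin q)) :=
  [set A | exists x s, V x /\ A = [set w | w x = s]].

Definition config (d q : nat) := g_sigma_algebraType (@cylinders d q setT).

(* The sigma-algebra of the events that depend only on the sites of V. *)
Definition sigma_on (d q : nat) (V : set (lattice d)) : set (set (config d q)) :=
  <<s @cylinders d q V >>.

(* The elementary conditional probability Pr(A | E), equal to 0 if Pr(E) = 0. *)
Definition cond_pr (R : realType) (d q : nat) (Pr : probability (config d q) R)
    (A E : set (config d q)) : R :=
  fine (Pr (A `&` E)) / fine (Pr E).

Definition translation_invariant (R : realType) (d q : nat)
    (Pr : probability (config d q) R) : Prop :=
  forall (a : lattice d) (A : set (config d q)), measurable A ->
    Pr [set w : config d q | A (fun x => w (x + a))] = Pr A.

(* g is a version of the conditional probability of A given the configuration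
   on V. *)
Definition cond_version (R : realType) (d q : nat)
    (Pr : probability (config d q) R) (V : set (lattice d))
    (A : set (config d q)) (g : config d q -> R) : Prop :=
  (forall Y : set R, measurable Y -> sigma_on V (g @^-1` Y)) /\
  (forall B, sigma_on V B ->
     Pr (A `&` B) = (\int[Pr]_(w in B) (g w)%:E)%E).

(* Conditional probabilities given the whole configuration off x are only
   defined up to null sets, so the bounds are required of some version. *)
Definition finite_energy (R : realType) (d q : nat)
    (Pr : probability (config d q) R) : Prop :=
  exists h : R, 0 < h < 1 /\
    forall (x : lattice d) (s : spin q),
      exists g : config d q -> R,
        cond_version Pr [set~ x] [set w : config d q | w x = s] g /\
        forall sigma, h <= g sigma <= 1 - h.

Definition adj (d : nat) : rel (lattice d) :=
  fun x y => \sum_(i < d) `|y 0 i - x 0 i| == 1.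

Definition outer_bd (d : nat) (V : set (lattice d)) : set (lattice d) :=
  \bigcup_(x in V) ([set y | adj x y] `\` V).

Definition all_in_state (d q : nat) (s : spin q) (W : set (lattice d)) :
    set (config d q) :=
  [set w : config d q | forall x, W x -> w x = s].

Definition boundary_markov (R : realType) (d q : nat) (s : spin q)
    (Pr : probability (config d q) R) : Prop :=
  forall V : set (lattice d), finite_set V ->
  forall A B : set (config d q),
    sigma_on V A -> sigma_on (~` (V `|` outer_bd V)) B ->
    let E := all_in_state s (outer_bd V) in
    cond_pr Pr (A `&` B) E = cond_pr Pr A E * cond_pr Pr B E.

Definition occupied (d q : nat) (w : config d q) (x : lattice d) : Prop :=
  w x = spin1 q.

Definition cluster_at (d q : nat) (w : config d q) (x : lattice d) :
    set (lattice d) :=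
  [set y | exists p : seq (lattice d),
     [/\ path (@adj d) x p, last x p = y
       & forall z, z \in x :: p -> occupied w z]].

Definition cluster0 (d q : nat) (w : config d q) : set (lattice d) :=
  cluster_at w 0.

Definition size_eq (d q n : nat) : set (config d q) :=
  [set w | (cluster0 w #= `I_n)%card].

Arguments size_eq : clear implicits.

Definition size_ge_fin (d q n : nat) : set (config d q) :=
  [set w | (`I_n #<= cluster0 w)%card /\ finite_set (cluster0 w)].

Arguments size_ge_fin : clear implicits.

Definition exponential_tail (R : realType) (d q : nat)
    (Pr : probability (config d q) R) (mu : R) : Prop :=
  [/\ 0 < mu <= 1,
      (fun n : nat => fine (Pr (size_eq d q n)) `^ (n%:R^-1)) @ \oo --> mu
    & (fun n : nat => fine (Pr (size_ge_fin d q n)) `^ (n%:R^-1)) @ \oo --> mu].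

Definition stretched_tail (R : realType) (d q : nat)
    (Pr : probability (config d q) R) (beta : R) : Prop :=
  exists nu : R,
  [/\ 0 < nu < 1,
      (fun n : nat => fine (Pr (size_eq d q n)) `^ ((n%:R `^ beta)^-1))
        @ \oo --> nu
    & (fun n : nat => fine (Pr (size_ge_fin d q n)) `^ ((n%:R `^ beta)^-1))
        @ \oo --> nu].

Definition cube (d r : nat) : set (lattice d) :=
  [set x | forall i, 0 <= x 0 i < r%:Z].
Arguments cube : clear implicits.

Definition cube_ext (d r : nat) : set (lattice d) :=
  [set x | forall i, -1 <= x 0 i < r%:Z + 1].
Arguments cube_ext : clear implicits.

Definition cube_bd (d r : nat) : set (lattice d) := cube_ext d r `\` cube d r.
Arguments cube_bd : clear implicits.

Definition pattern (d q r : nat) : Type := cube d r -> spin q.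

Definition occurs_at (d q r : nat) (P : pattern d q r) (x : lattice d)
    (w : config d q) : Prop :=
  forall y : cube d r, w (x + \val y) = P y.

Definition occurs_on_cluster_at (d q r : nat) (P : pattern d q r)
    (x : lattice d) (w : config d q) : Prop :=
  occurs_at P x w /\ [set x + y | y in cube_bd d r] `<=` cluster0 w.

Definition grid (d r : nat) : set (lattice d) :=
  [set x | exists k : lattice d, x = k *+ (r + 2) + const_mx 1].
Arguments grid : clear implicits.

(* The set counted is finite whenever the cluster of the origin is; otherwise
   fset_set may return the dummy value fset0. *)
Definition npat (d q r : nat) (P : pattern d q r) (w : config d q) : nat :=
  #|` fset_set [set x | grid d r x /\ occurs_on_cluster_at P x w]|%fset.

Definition pattern_cluster (d q r : nat) (P : pattern d q r) :
    set (lattice d) :=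
  [set x | exists y : cube d r,
     [/\ x = \val y, P y = spin1 q
       & exists p : seq (lattice d),
         [/\ path (@adj d) x p, cube_bd d r (last x p)
           & forall z : cube d r, \val z \in x :: p -> P z = spin1 q]]].

Definition cpat (d q r : nat) (P : pattern d q r) : nat :=
  #|` fset_set (pattern_cluster P)|%fset.

Definition boxed (d q r : nat) (P : pattern d q r) : set (config d q) :=
  [set w : config d q | (forall y : cube d r, w (\val y) = P y) /\
                        (forall x, cube_bd d r x -> w x = spin1 q)].

Definition gamma_ratio (R : realType) (d q r : nat)
    (Pr : probability (config d q) R) (mu : R) (P P' : pattern d q r) : R :=
  (mu ^+ cpat P' * fine (Pr (boxed P))) / (mu ^+ cpat P * fine (Pr (boxed P'))).

(* Main.v *)
Require Import Defs.
From HB Require Import structures.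
From mathcomp Require Import all_boot all_order all_algebra.
From mathcomp Require Import finmap.
From mathcomp Require Import all_classical all_reals all_analysis.
From mathcomp Require Import measurable_realfun.
From mathcomp Require Import zify ring lra.

Import Order.TTheory GRing.Theory Num.Theory.
Import numFieldNormedType.Exports.

Local Open Scope classical_set_scope.
Local Open Scope ring_scope.

(** The theorem rests on a switching argument.  Write p(n, a, b) for the
    probability that |C| = n, N_P = a and N_P' = b.

    Suppose that P occurs at the grid site x on C.  The boundary of the cube Q_x
    is then part of C, and it is connected because d >= 2; therefore overwriting
    P by P' inside Q_x leaves C unchanged outside Q_x.  The size of C changes by
    c_P' - c_P, the count N_P drops by one and N_P' grows by one
    ([switch_event]).  As Q_x is surrounded by ones, the boundary-1 Markov
    property makes the probabilities before and after the switch proportional,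
    with the constant ratio rho = Pr(box P) / Pr(box P') ([switch_prob]).  A
    configuration with N_P = a+1 can be switched at a+1 sites, and one with
    N_P' = b+1 can be switched back at b+1 sites, so that summation over x gives

      (a+1) p(n + c_P, a+1, b) = rho (b+1) p(n + c_P', a, b+1)

    ([switch_identity]).  If a >= rho b + eps n^alpha, one switch therefore costs
    a factor at most exp(- eps n^(alpha-1) / 2), and this remains true during
    j ~ eta n^alpha successive switches for a small eta.  Multiplying the factors,

      Pr(N_P >= rho N_P' + eps n^alpha, |C| = n)
        <= exp(- c n^(2 alpha - 1)) Pr(|C| = n'),   n' = n + j (c_P' - c_P)

    ([excess_bound]).

    In part (i), n' = n and gamma = rho, so dividing by Pr(|C| = n) is enough; the
    lower deviation is the upper one with P and P' exchanged
    ([equal_size_case]).  In part (ii), the stretched exponential tail forces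
    mu = 1 ([stretched_tail_mu1]), hence again gamma = rho, and
    Pr(|C| = n') / Pr(|C| = n) is exp(o(n^(2 alpha - 1))): when
    2 alpha - 1 > beta because the denominator is exp(- O(n^beta)), and when
    2 alpha - 1 = beta because then alpha < 1, so that n' / n is close to 1 or
    larger ([stretched_case]). *)

Set Implicit Arguments.
Unset Strict Implicit.
Unset Printing Implicit Defensive.

(** * Paths and the boundary of a cube *)
Lemma adj_sym d (x y : lattice d) : adj x y = adj y x.
Proof.
by rewrite /adj; congr (_ == _); apply: eq_bigr => i _; rewrite distrC.
Qed.

Lemma adj_shift d (a x y : lattice d) : adj (x - a) (y - a) = adj x y.
Proof.
rewrite /adj; congr (_ == _); apply: eq_bigr => i _.
by rewrite !mxE; congr (`| _ |); ring.
Qed.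

Lemma path_shift d (a x : lattice d) p :
  path (@adj d) (x - a) [seq z - a | z <- p] = path (@adj d) x p.
Proof. by elim: p x => //= y p IH x; rewrite adj_shift IH. Qed.

Lemma adj_coord d (x y : lattice d) i : adj x y -> `|y 0 i - x 0 i| <= 1.
Proof.
move=> /eqP <-; rewrite (bigD1 i) //= lerDl; exact: sumr_ge0.
Qed.

Definition conn d (S : set (lattice d)) (x y : lattice d) : Prop :=
  exists p : seq (lattice d),
    [/\ path (@adj d) x p, last x p = y & forall z, z \in x :: p -> S z].

Section Conn.
Variables (d : nat) (S : set (lattice d)).
Implicit Types x y z : lattice d.

Lemma conn_refl x : S x -> conn S x x.
Proof. by move=> Sx; exists [::]; split=> // z; rewrite inE => /eqP->. Qed.

Lemma conn_r x y : conn S x y -> S y.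
Proof. by case=> p [_ <-]; apply; exact: mem_last. Qed.

Lemma conn_l x y : conn S x y -> S x.
Proof. by case=> p [_ _]; apply; rewrite mem_head. Qed.

Lemma conn_step x y z : conn S x y -> adj y z -> S z -> conn S x z.
Proof.
case=> p [pp lp Sp] yz Sz; exists (rcons p z); split.
- by rewrite rcons_path pp lp.
- by rewrite last_rcons.
- move=> t; rewrite -rcons_cons mem_rcons inE => /orP[/eqP->//|]; exact: Sp.
Qed.

(** Paths are extended at their far end, so that a property can be followed
    outwards from the starting point, the origin in the case of a cluster. *)
Lemma conn_ind x (Q : lattice d -> Prop) : Q x ->
  (forall u v, conn S x u -> S v -> Q u -> adj u v -> Q v) ->
  forall y, conn S x y -> Q y.
Proof.
move=> Qx IH y [p]; elim/last_ind: p y => [|p z IHp] y [].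
  by move=> _ /= <-.
rewrite rcons_path last_rcons => /andP[pp az] <- Sp.
have Sp' t : t \in x :: p -> S t.
  by move=> tp; apply: Sp; rewrite -rcons_cons mem_rcons inE tp orbT.
apply: (IH (last x p)) => //.
- by exists p; split.
- by apply: Sp; rewrite -rcons_cons mem_rcons mem_head.
- by apply: IHp; split.
Qed.

Lemma conn_trans x y z : conn S x y -> conn S y z -> conn S x z.
Proof.
move=> xy; move: z; apply: conn_ind => // u v _ Sv xu uv; exact: (conn_step xu).
Qed.

Lemma conn_sym x y : conn S x y -> conn S y x.
Proof.
move=> xy; move: (xy); apply: (@conn_ind x (fun y => conn S y x)) => [|u v _ Sv ux uv].
  by apply: conn_refl; exact: conn_l xy.
have Su := conn_l ux; apply: conn_trans ux; apply: conn_step (conn_refl Sv) _ Su.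
by rewrite adj_sym.
Qed.

End Conn.

Lemma conn_sub d (S T : set (lattice d)) x y :
  S `<=` T -> conn S x y -> conn T x y.
Proof. by move=> ST [p [pp lp Sp]]; exists p; split=> // z /Sp /ST. Qed.

Lemma cube_bdP d r (y : lattice d) : cube_bd d r y <->
  (forall i, -1 <= y 0 i <= r%:Z) /\ exists i, y 0 i = -1 \/ y 0 i = r%:Z.
Proof.
split=> [[ye yn]|[yb [i yi]]].
  split=> [i|]; first by have := ye i; lia.
  have /existsNP[i yi] := yn; exists i; have := ye i; lia.
split=> [j|/(_ i)]; [have := yb j|]; lia.
Qed.

Definition lower d (y : lattice d) (j : 'I_d) : lattice d := y - delta_mx 0 j.

Lemma lowerE d (y : lattice d) j i : lower y j 0 i = y 0 i - (i == j)%:Z.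
Proof. by rewrite !mxE eqxx /=; case: (i == j). Qed.

Lemma adj_lower d (y : lattice d) j : adj y (lower y j).
Proof.
rewrite /adj (bigD1 j) //= lowerE eqxx big1 => [|i ij]; last by rewrite lowerE (negbTE ij); lia.
lia.
Qed.

(** Every boundary site is joined to the corner (-1, ..., -1) by lowering one
    coordinate at a time, always keeping another coordinate at an extreme value
    so as not to leave the boundary.  This is where d >= 2 enters: for d = 1
    the boundary consists of two sites on either side of the cube. *)
Lemma cube_bd_conn d r : (2 <= d)%N -> forall u v : lattice d,
  cube_bd d r u -> cube_bd d r v -> conn (cube_bd d r) u v.
Proof.
move=> d2; pose c : lattice d := const_mx (-1).
suff toc u : cube_bd d r u -> conn (cube_bd d r) u c.
  by move=> u v /toc uc /toc vc; exact: conn_trans uc (conn_sym vc).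
pose m (v : lattice d) := (\sum_i absz (v 0%R i + 1)%R)%N.
move=> Du; have [n] := ubnP (m u).
elim: n u Du => // n IH u Du un.
have [uc|/eqP uc] := eqVneq u c; first by rewrite uc; apply: conn_refl; rewrite -uc.
have [ub [i ui]] := (cube_bdP r u).1 Du.
(* lower the coordinate j while k pins the site to the boundary *)
have [j uj [k kj uk]] : exists2 j, -1 < u 0 j &
    exists2 k, k != j & u 0 k = -1 \/ u 0 k = r%:Z.
  have [[j ji uj]|H] := pselect (exists2 j, j != i & -1 < u 0 j).
    by exists j => //; exists i => //; rewrite eq_sym.
  have H' j : j != i -> u 0 j = -1.
    move=> ji; have := ub j; have [//|] := ltP (-1) (u 0 j); last lia.
    by move=> uj; case: H; exists j.
  exists i.
    have [//|ui'] := ltP (-1) (u 0 i); case: uc; apply/rowP => j; rewrite mxE.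
    have [->|/H'//] := eqVneq j i; apply/eqP; rewrite eq_le ui' /=.
    by case/andP: (ub i).
  have [k ki] : exists k : 'I_d, k != i.
    have d0 : (0 < d)%N by lia.
    have [i0|i0] := eqVneq (i : nat) 0%N.
      by exists (Ordinal d2); apply/eqP => /(congr1 val) /=; lia.
    by exists (Ordinal d0); apply/eqP => /(congr1 val) /=; lia.
  by exists k => //; left; exact: H'.
have Dd : cube_bd d r (lower u j).
  apply/cube_bdP; split=> [l|].
    by rewrite lowerE; have := ub l; have [->|] := eqVneq l j => /=; lia.
  by exists k; rewrite lowerE (negbTE kj); lia.
apply: conn_trans (IH _ Dd _); first exact: conn_step (conn_refl Du) (adj_lower u j) Dd.
have lt_sum : (m (lower u j) < m u)%N.
  rewrite /m (bigD1 j) //= [ltnRHS](bigD1 j) //= lowerE eqxx /=.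
  rewrite (eq_bigr (fun l => absz (u 0%R l + 1)%R)) => [|l lj]; last first.
    by rewrite lowerE (negbTE lj); congr absz; lia.
  by rewrite ltn_add2r; lia.
by move: un; rewrite ltnS => /(leq_trans lt_sum).
Qed.

Lemma cube_nbr d r (u v : lattice d) :
  cube d r u -> adj u v -> ~ cube d r v -> cube_bd d r v.
Proof.
move=> uQ uv vQ; split=> // i; have := uQ i; have := adj_coord i uv; lia.
Qed.

Definition splice d q (V : set (lattice d)) (u w : config d q) : config d q :=
  fun z => if z \in V then u z else w z.

Lemma splice_in d q (V : set (lattice d)) (u w : config d q) z :
  V z -> splice V u w z = u z.
Proof. by move=> Vz; rewrite /splice mem_set. Qed.

Lemma splice_out d q (V : set (lattice d)) (u w : config d q) z :
  ~ V z -> splice V u w z = w z.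
Proof. by move=> Vz; rewrite /splice memNset. Qed.

Definition cube_at d r (x : lattice d) : set (lattice d) :=
  [set z | cube d r (z - x)].
Definition bd_at d r (x : lattice d) : set (lattice d) :=
  [set z | cube_bd d r (z - x)].

(** Total extension of a pattern: its values can be used at a site without a
    proof that the site lies in the cube.  The value off the cube is arbitrary. *)
Definition pattern_ext d q r (P : pattern d q r) : lattice d -> spin q :=
  fun z => oapp P ord0 (insub z).

Lemma pattern_extE d q r (P : pattern d q r) (y : cube d r) : pattern_ext P (\val y) = P y.
Proof. by rewrite /pattern_ext valK. Qed.

Lemma cubeE d r (z : lattice d) : cube d r z -> exists y : cube d r, \val y = z.
Proof. by move=> zQ; exists (SigSub (mem_set zQ)). Qed.

Lemma cube_val d r (y : cube d r) : cube d r (\val y).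
Proof. exact: set_mem (valP y). Qed.

Lemma occurs_atP d q r (P : pattern d q r) x w : occurs_at P x w <->
  forall z, cube_at r x z -> w z = pattern_ext P (z - x).
Proof.
split=> [H z /cubeE[y yz]|H y].
  by rewrite -yz pattern_extE -H yz subrKC.
have e : x + \val y - x = \val y by rewrite addrC addKr.
rewrite H ?e ?pattern_extE // /cube_at /= e; exact: cube_val.
Qed.

Lemma occurs_onP d q r (P : pattern d q r) x w : occurs_on_cluster_at P x w <->
  (forall z, cube_at r x z -> w z = pattern_ext P (z - x)) /\ bd_at r x `<=` cluster0 w.
Proof.
rewrite /occurs_on_cluster_at occurs_atP; split=> -[H1 H2]; split=> // z.
  by move=> zb; apply: H2; exists (z - x) => //; rewrite subrKC.
by case=> y yb <-; apply: H2; rewrite /bd_at /= (addrC x) addrK.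
Qed.

Lemma clusterE d q (w : config d q) x y : cluster_at w x y = conn (occupied w) x y.
Proof. by []. Qed.

Lemma bd_at_conn d r (x u v : lattice d) : (2 <= d)%N ->
  bd_at r x u -> bd_at r x v -> conn (bd_at r x) u v.
Proof.
move=> d2 ub vb; have := cube_bd_conn d2 ub vb.
set S := cube_bd d r.
suff : forall y, conn S (u - x) y -> conn (bd_at r x) u (y + x).
  by move=> /[apply]; rewrite subrK.
apply: conn_ind => [|s t _ St us st]; first by rewrite subrK; exact: conn_refl.
by apply: (conn_step us); [rewrite -(adj_shift x) !addrK|rewrite /bd_at /= addrK].
Qed.

Lemma bd_at_out d r (x z : lattice d) : bd_at r x z -> ~ cube_at r x z.
Proof. by case. Qed.

Lemma cube_at_nbr d r (x u v : lattice d) :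
  cube_at r x u -> adj u v -> ~ cube_at r x v -> bd_at r x v.
Proof. by move=> uQ uv vQ; apply: (@cube_nbr _ _ (u - x)); rewrite ?adj_shift. Qed.

(** A path of C that crosses the cube enters it from a boundary site and leaves
    it at a boundary site.  The boundary being connected, occupied and off the
    cube, the crossing can be replaced by a detour along the boundary, which does
    not depend on the states inside. *)
Lemma cluster_off_cube d q r (x : lattice d) (w w' : config d q) : (2 <= d)%N ->
  ~ cube_at r x 0 -> bd_at r x `<=` cluster0 w ->
  (forall z, ~ cube_at r x z -> w' z = w z) ->
  cluster0 w `\` cube_at r x `<=` cluster0 w'.
Proof.
move=> d2 nV0 bC ww' z [].
have bO v : bd_at r x v -> occupied w' v.
  by move=> bv; rewrite /occupied ww'; [exact: (conn_r (bC _ bv))|exact: bd_at_out].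
have spread u : bd_at r x u -> cluster0 w' u -> bd_at r x `<=` cluster0 w'.
  move=> bu Cu v bv; apply: (conn_trans Cu); apply: conn_sub (bd_at_conn d2 bu bv) => //.
(* once the path has entered the cube, the whole boundary is in the new cluster *)
pose Q u := (~ cube_at r x u -> cluster0 w' u) /\
            (cube_at r x u -> bd_at r x `<=` cluster0 w').
suff HQ : forall y, cluster0 w y -> Q y by move=> /HQ[].
move=> y; rewrite /cluster0 clusterE => C0y; move: (C0y); move: y C0y => y0 C0.
apply: conn_ind => [|u v Cu Ov [Qu1 Qu2] uv].
  split=> // _; apply: conn_refl; rewrite /occupied ww' //; exact: (conn_l C0).
have [uV|uV] := pselect (cube_at r x u); have [vV|vV] := pselect (cube_at r x v).
- by split=> // _; exact: Qu2.
- by split=> // _; apply: Qu2 => //; exact: cube_at_nbr uV uv vV.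
- split=> // _; apply: (spread u); last exact: Qu1.
  by apply: cube_at_nbr vV _ uV; rewrite adj_sym.
- split=> // _; apply: (conn_step (Qu1 uV)) uv _; rewrite /occupied ww'//.
Qed.

(** A path from the origin reaches a site of the cube through a boundary site,
    and all the boundary is in C; so membership in C is decided inside the cube. *)
Lemma cluster_in_cube d q r (x : lattice d) (P : pattern d q r) (w : config d q) :
  ~ cube_at r x 0 -> occurs_on_cluster_at P x w ->
  forall y, cube_at r x y -> (cluster0 w y <-> pattern_cluster P (y - x)).
Proof.
move=> nV0 /occurs_onP[wP bC] y yV; split.
  pose good u := exists p : seq (lattice d), [/\ path (@adj d) u p, bd_at r x (last u p)
     & forall z, z \in u :: p -> cube_at r x z -> pattern_ext P (z - x) = spin1 q].
  suff Hg u : cluster0 w u -> cube_at r x u -> good u.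
    move=> Cy; have [y' y'E] := cubeE yV; exists y'; split=> //.
    - by rewrite -pattern_extE y'E -wP //; exact: (conn_r Cy).
    - have [p [pp lp Hp]] := Hg _ Cy yV; exists [seq z - x | z <- p]; split.
      + by rewrite path_shift.
      + by rewrite (last_map (fun z => z - x)).
      + move=> z; rewrite -(map_cons (fun z => z - x)) => /mapP[t tp zE].
        rewrite -pattern_extE zE; apply: Hp => //.
        by rewrite /cube_at /= -zE; exact: cube_val.
  move: u; rewrite /cluster0 => u; rewrite clusterE.
  move: u; apply: conn_ind => // u v Cu Ov Qu uv vV.
  have [uV|uV] := pselect (cube_at r x u).
    have [p [pp lp Hp]] := Qu uV.
    exists (u :: p); split=> //=; first by rewrite adj_sym uv.
    move=> z; rewrite inE => /orP[/eqP-> _|/Hp//]; by rewrite -wP.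
  exists [:: u]; split=> /=.
  - by rewrite adj_sym uv.
  - by apply: cube_at_nbr vV _ uV; rewrite adj_sym.
  - by move=> z; rewrite !inE => /orP[/eqP-> _|/eqP->//]; rewrite -wP.
case=> y' [y'E Py' [p [pp lp Hp]]].
have {}Hp : forall z, z \in (y - x) :: p -> cube d r z -> pattern_ext P z = spin1 q.
  move=> z zp /cubeE[z' z'E]; rewrite -z'E pattern_extE; apply: Hp; by rewrite z'E.
clear y' y'E Py'; elim: p y yV pp lp Hp => [|z p IH] y yV /=.
  by move=> _ [].
move=> /andP[yz pp] lp Hp.
have yO : occupied w y by rewrite /occupied wP // Hp ?mem_head.
have zx : z = z + x - x by rewrite addrK.
have yz' : adj (z + x) y by rewrite adj_sym -(adj_shift x) addrK.
suff Cz : cluster0 w (z + x) by exact: conn_step Cz yz' yO.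
have [zV|zV] := pselect (cube d r z); last first.
  by apply: bC; rewrite /bd_at /= addrK; exact: cube_nbr yz zV.
apply: IH; rewrite /cube_at /= ?addrK // => t tp; apply: Hp.
by rewrite inE tp orbT.
Qed.

(** * Switching one pattern on the cluster *)
Lemma conn_path d (S : set (lattice d)) x p : path (@adj d) x p ->
  (forall z, z \in x :: p -> S z) -> forall z, z \in x :: p -> conn S x z.
Proof.
move=> pp Sp z; move: pp Sp => + + zp; case/splitPl: zp => p1 p2 lz.
rewrite cat_path => /andP[pp1 _] Sp; exists p1; split=> // t tp; apply: Sp.
by rewrite -cat_cons mem_cat tp.
Qed.

Lemma finite_box d (N : nat) :
  finite_set [set y : lattice d | forall i, `|y 0 i| <= N%:Z].
Proof.
pose f (g : {ffun 'I_d -> 'I_(N + N).+1}) : lattice d :=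
  \row_i ((g i : nat)%:Z - N%:Z).
apply: (@sub_finite_set _ _ (f @` setT)); last exact/finite_image/finite_finset.
move=> y yN; exists [ffun i => inord (absz (y 0 i + N%:Z))] => //.
apply/rowP => i; rewrite !mxE ffunE inordK; have := yN i; lia.
Qed.

Lemma path_coord d (x : lattice d) p i : path (@adj d) x p ->
  `|last x p 0 i - x 0 i| <= (size p)%:Z.
Proof.
elim: p x => [|y p IH] x /=; first by rewrite subrr normr0.
move=> /andP[/(adj_coord i) xy /IH]; lia.
Qed.

Lemma size_eqP d q n (w : config d q) : size_eq d q n w <->
  finite_set (cluster0 w) /\ #|` fset_set (cluster0 w)|%fset = n.
Proof.
split=> [wn|[fC <-]]; first by split; [apply/finite_setP; exists n|exact: card_fset_set].
rewrite /size_eq /=; have /finite_setP[m Cm] := fC.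
by rewrite (card_fset_set Cm).
Qed.

(** The sites of a self-avoiding path inside C are distinct sites of C, so the
    path has at most n of them. *)
Lemma cluster_box d q n (w : config d q) : size_eq d q n w ->
  cluster0 w `<=` [set y | forall i, `|y 0 i| <= n%:Z].
Proof.
move=> /size_eqP[fC Cn] y /= [p [pp lp Hp]] i; subst y.
move: Hp; case/shortenP: pp => p' pp' up' sp' Hp.
have Hp' z : z \in 0 :: p' -> occupied w z.
  rewrite inE => /orP[/eqP->|/sp' zp]; apply: Hp; first exact: mem_head.
  by rewrite inE zp orbT.
have := path_coord i pp'; rewrite mxE subr0 => /le_trans; apply.
rewrite lez_nat; apply: (@leq_trans (size (0 :: p'))) => //.
rewrite -Cn; apply: uniq_leq_size => // z zp.
by rewrite in_fset_set // mem_set //; exact: conn_path pp' Hp' z zp.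
Qed.

Definition occ d q r (P : pattern d q r) (w : config d q) : set (lattice d) :=
  [set x | grid d r x /\ occurs_on_cluster_at P x w].

Lemma npatE d q r (P : pattern d q r) w :
  npat P w = #|` fset_set (occ P w)|%fset.
Proof. by []. Qed.

Lemma corner_bd d r (x : lattice d) : (0 < d)%N -> bd_at r x (x + const_mx (-1)).
Proof.
move=> d0; rewrite /bd_at /= addrC addKr; apply/cube_bdP; split=> [i|]; first by rewrite mxE; lia.
by exists (Ordinal d0); rewrite mxE; left.
Qed.

(** The lowest corner of the boundary around an occurrence belongs to C and
    determines the occurrence, hence N_P <= |C|. *)
Lemma occ_sub d q r (P : pattern d q r) w : (0 < d)%N ->
  occ P w `<=` (fun z => z - const_mx (-1)) @` cluster0 w.
Proof.
move=> d0 x [_ /occurs_onP[_ bC]]; exists (x + const_mx (-1)); last exact: addrK.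
exact/bC/corner_bd.
Qed.

Lemma occ_finite d q r (P : pattern d q r) w : (0 < d)%N ->
  finite_set (cluster0 w) -> finite_set (occ P w).
Proof. by move=> d0 fC; apply: sub_finite_set (occ_sub d0) (finite_image _ fC). Qed.

Lemma npat_le d q r (P : pattern d q r) w n : (0 < d)%N ->
  size_eq d q n w -> (npat P w <= n)%N.
Proof.
move=> d0 /size_eqP[fC <-]; rewrite npatE.
apply: (@leq_trans #|` fset_set ((fun z => z - const_mx (-1)) @` cluster0 w)|%fset).
  apply: fsubset_leq_card; rewrite -fset_set_sub //.
  - exact: occ_sub.
  - exact: occ_finite.
  - exact: finite_image.
by rewrite fset_set_image // card_imfset //; exact: addIr.
Qed.

Lemma occ_box d q r (P : pattern d q r) w n : (0 < d)%N -> size_eq d q n w ->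
  occ P w `<=` [set y | forall i, `|y 0 i| <= n.+1%:Z].
Proof.
move=> d0 wn y /(occ_sub d0)[z /(cluster_box wn) zn <-] i.
have -> : (z - const_mx (-1)) 0 i = z 0 i + 1 by rewrite !mxE opprK.
by have := zn i; lia.
Qed.

Lemma grid_coord d r (x : lattice d) i : grid d r x ->
  exists k : int, x 0 i = k * (r%:Z + 2) + 1.
Proof.
case=> k ->; exists (k 0 i); rewrite mxE mulmxnE mxE -[_ *+ _]mulr_natr natrD.
by rewrite natz.
Qed.

(** The grid has spacing r + 2, the side of the extended cube, so a switch in one
    cube affects neither the other cubes nor their boundaries. *)
Lemma grid_disj d r (x y z : lattice d) : grid d r x -> grid d r y ->
  cube_at r x z -> cube_ext d r (z - y) -> x = y.
Proof.
move=> gx gy zx zy; apply/rowP => i.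
have [k xk] := grid_coord i gx; have [l yl] := grid_coord i gy.
move: (zx i) (zy i); rewrite !mxE xk yl.
move: (z _ _) => t h1 h2; suff -> : k = l by [].
nia.
Qed.

(** The offset (1, ..., 1) of the grid keeps the origin out of all the cubes:
    a switch never changes the state of the root of the cluster. *)
Lemma grid_out0 d r (x : lattice d) : (0 < d)%N -> grid d r x -> ~ cube_at r x 0.
Proof.
move=> d0 gx; have [k xk] := grid_coord (Ordinal d0) gx.
move=> /(_ (Ordinal d0)); rewrite sub0r mxE xk.
have [k0|k0] : 0 <= k \/ k <= -1 by lia.
  nia.
have : k * (r%:Z + 2) <= -1 * (r%:Z + 2) by rewrite ler_wpM2r.
lia.
Qed.

Lemma cube_finite d r : finite_set (cube d r).
Proof.
apply: sub_finite_set (finite_box d r) => y yQ i; have := yQ i; lia.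
Qed.

Lemma pattern_cluster_sub d q r (P : pattern d q r) : pattern_cluster P `<=` cube d r.
Proof. by move=> z [y [-> _ _]]; exact: cube_val. Qed.

Section Switch.
Variables (d q r : nat) (d2 : (2 <= d)%N) (P P' : pattern d q r).
Variables (w w' : config d q) (x : lattice d).
Hypothesis xP : occ P w x.
Hypothesis w'V : forall z, cube_at r x z -> w' z = pattern_ext P' (z - x).
Hypothesis w'out : forall z, ~ cube_at r x z -> w' z = w z.

Let gx : grid d r x. Proof. by case: xP. Qed.
Let d0 : (0 < d)%N. Proof. exact: ltnW. Qed.
Let bC : bd_at r x `<=` cluster0 w.
Proof. by case: xP => _ /occurs_onP[]. Qed.

Lemma switch_bd : bd_at r x `<=` cluster0 w'.
Proof.
move=> z bz; apply: (cluster_off_cube d2 (grid_out0 d0 gx) bC w'out).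
by split; [exact: bC|exact: bd_at_out].
Qed.

Lemma switch_occ : occ P' w' x.
Proof. by split=> //; apply/occurs_onP; split=> //; exact: switch_bd. Qed.

Lemma switch_cluster : cluster0 w' `\` cube_at r x = cluster0 w `\` cube_at r x.
Proof.
apply/seteqP; split=> z zC; (split; last by case: zC).
- apply: (cluster_off_cube d2 (grid_out0 d0 gx) switch_bd _ zC) => y /w'out.
  by move=> ->.
- exact: (cluster_off_cube d2 (grid_out0 d0 gx) bC w'out).
Qed.

Lemma switch_other (T : pattern d q r) : occ T w' `\ x = occ T w `\ x.
Proof.
have other y : grid d r y -> y <> x -> occurs_on_cluster_at T y w' <-> occurs_on_cluster_at T y w.
  move=> gy yx.
  have off z : cube_ext d r (z - y) -> ~ cube_at r x z.
    by move=> ze zx; apply: yx; rewrite (grid_disj gx gy zx ze).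
  have offc z : cube_at r y z -> ~ cube_at r x z.
    move=> zy; apply: off => i; have := zy i; lia.
  have offb z : bd_at r y z -> ~ cube_at r x z by case=> ze _; exact: off.
  have e z : ~ cube_at r x z -> cluster0 w' z <-> cluster0 w z.
    move=> zx; have /seteqP[s1 s2] := switch_cluster.
    by split=> Cz; [have [] := s1 _ (conj Cz zx)|have [] := s2 _ (conj Cz zx)].
  rewrite !occurs_onP; split=> -[H1 H2]; split=> z zz.
  - by rewrite -H1 // w'out //; exact: offc.
  - by apply/e; [exact: offb|exact: H2].
  - by rewrite -H1 // w'out //; exact: offc.
  - by apply/e; [exact: offb|exact: H2].
by apply/seteqP; split=> y [[gy Hy] yx]; split=> //; split=> //; apply/other.
Qed.

End Switch.

Lemma cluster_card d q r (P : pattern d q r) w x : (0 < d)%N -> occ P w x ->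
  finite_set (cluster0 w) ->
  #|` fset_set (cluster0 w)|%fset =
  (cpat P + #|` fset_set (cluster0 w `\` cube_at r x)|%fset)%N.
Proof.
move=> d0 [gx ox] fC.
rewrite /cpat (_ : fset_set (cluster0 w `\` cube_at r x) =
  (fset_set (cluster0 w) `\` fset_set (cluster0 w `&` cube_at r x))%fset); last first.
  rewrite -fset_setD //; last exact: finite_setIl.
  by congr fset_set; rewrite setDIr setDv set0U.
rewrite -(cardfsID (fset_set (cluster0 w `&` cube_at r x))); congr addn.
rewrite -fset_setI //; last exact: finite_setIl.
rewrite setIA setIid.
suff -> : cluster0 w `&` cube_at r x = (fun z => z + x) @` pattern_cluster P.
  rewrite fset_set_image; last first.
    exact: sub_finite_set (@pattern_cluster_sub _ _ _ P) (@cube_finite _ _).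
  by rewrite card_imfset //; exact: addIr.
apply/seteqP; split=> [y [yC yV]|y [z zP <-]].
  exists (y - x); last exact: subrK.
  exact/(cluster_in_cube (grid_out0 d0 gx) ox yV).
have zV : cube_at r x (z + x).
  by rewrite /cube_at /= addrK; exact: pattern_cluster_sub zP.
by split=> //; apply/(cluster_in_cube (grid_out0 d0 gx) ox zV); rewrite addrK.
Qed.

Lemma occ_neq d q r (P P' : pattern d q r) w x : P <> P' -> occ P w x -> ~ occ P' w x.
Proof.
move=> PP' [_ [oP _]] [_ [oP' _]]; apply: PP'; apply/funext => y.
by rewrite -oP oP'.
Qed.

Definition joint_counts d q r (P P' : pattern d q r) (n a b : nat) : set (config d q) :=
  [set w | [/\ size_eq d q n w, npat P w = a & npat P' w = b]].

(** Off the cube at x the cluster is unchanged, so all other occurrences survive,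
    and inside the cube its share c_P is replaced by c_P'.  Exchanging P and P'
    in this lemma gives the inverse switch. *)
Lemma switch_event d q r (P P' : pattern d q r) w w' x n a b :
  (2 <= d)%N -> P <> P' ->
  (forall z, cube_at r x z -> w' z = pattern_ext P' (z - x)) ->
  (forall z, ~ cube_at r x z -> w' z = w z) ->
  (joint_counts P P' (n + cpat P) a.+1 b `&` [set w | occ P w x]) w ->
  (joint_counts P P' (n + cpat P') a b.+1 `&` [set w | occ P' w x]) w'.
Proof.
move=> d2 PP' h1 h2 [[/size_eqP[fC Cn] Na Nb] oP].
have d0 : (0 < d)%N by exact: ltnW.
have oP' := switch_occ d2 oP h1 h2.
have fC' : finite_set (cluster0 w').
  have : finite_set (cluster0 w `\` cube_at r x `|` cube_at r x).
    rewrite finite_setU; split; first exact: finite_setD.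
    apply: (@sub_finite_set _ _ ((fun z => z + x) @` cube d r)); last exact/finite_image/cube_finite.
    by move=> z zV; exists (z - x) => //; exact: subrK.
  rewrite -(switch_cluster d2 oP h2); apply: sub_finite_set => z Cz.
  by have [?|?] := pselect (cube_at r x z); [right|left].
have fo T := @occ_finite _ _ _ T _ d0 fC; have fo' T := @occ_finite _ _ _ T _ d0 fC'.
split=> //; split.
- apply/size_eqP; split=> //.
  rewrite (cluster_card d0 oP') // (switch_cluster d2 oP h2).
  by move: Cn; rewrite (cluster_card d0 oP) //; lia.
- rewrite npatE; have := switch_other d2 oP h2 P.
  have nx : ~ occ P w' x by apply: occ_neq oP'; exact: nesym.
  rewrite not_setD1 // => ->; rewrite fset_setD1 //.
  move: Na; rewrite npatE (cardfsD1 x) in_fset_set // mem_set //; lia.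
- rewrite npatE (cardfsD1 x) in_fset_set // mem_set // -fset_setD1 //.
  rewrite (switch_other d2 oP h2 P') not_setD1; last exact: occ_neq oP.
  by rewrite -npatE Nb.
Qed.

(** * Measurability and double counting *)
Section Countable.
Context {dsp : measure_display} {T : measurableType dsp}.
Implicit Types (I : countType).

Lemma bigcup_countable_measurable I (D : set I) (F : I -> set T) :
  (forall i, D i -> measurable (F i)) -> measurable (\bigcup_(i in D) F i).
Proof.
move=> mF; rewrite (_ : \bigcup_(i in D) F i = \bigcup_i (if `[<D i>] then F i else set0)).
  apply: countable_bigcupT_measurable => // i.
  by case: asboolP => [/mF//|_]; exact: measurable0.
apply/seteqP; split=> [t [i Di Ft]|t [i _]].
  by exists i => //; case: asboolP.
by case: asboolP => // Di Ft; exists i.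
Qed.

Lemma bigcap_countable_measurable I (D : set I) (F : I -> set T) :
  (forall i, D i -> measurable (F i)) -> measurable (\bigcap_(i in D) F i).
Proof.
move=> mF; rewrite -[X in measurable X]setCK setC_bigcap; apply: measurableC.
by apply: bigcup_countable_measurable => i /mF/measurableC.
Qed.

(** A countable type has only countably many finite subsets, and the event that
    the random set equals a given one is a countable intersection. *)
Lemma random_set_card_measurable I (g : T -> set I) n :
  (forall i, measurable [set t | g t i]) ->
  measurable [set t | finite_set (g t) /\ #|` fset_set (g t)|%fset = n].
Proof.
move=> mg.
have mX (X : {fset I}) : measurable [set t | g t = [set` X]].
  rewrite (_ : mkset _ = \bigcap_(i in setT)
    (if i \in X then [set t | g t i] else ~` [set t | g t i])); last first.
    apply/seteqP; split=> [t /= gX i _|t /= gX].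
      by case: ifPn => iX /=; rewrite gX //=; exact/negP.
    by apply/seteqP; split=> i /=; have := gX i Logic.I; case: ifPn.
  apply: bigcap_countable_measurable => i _.
  by case: ifPn => _ //; exact: measurableC.
rewrite (_ : mkset _ = \bigcup_(X in [set X : {fset I} | #|` X|%fset = n])
  [set t | g t = [set` X]]); first exact: bigcup_countable_measurable.
apply/seteqP; split=> [t /= [fg gn]|t /= [X /= Xn ->]]; last by rewrite set_fsetK.
by exists (fset_set (g t)) => //=; rewrite fset_setK.
Qed.

(** Double counting: integrate the inequality between sums of indicators. *)
Lemma sum_prob_le (R : realType) (P : probability T R) (I J : Type)
    (s : seq I) (t : seq J) (A : I -> set T) (B : J -> set T) :
  (forall i, measurable (A i)) -> (forall j, measurable (B j)) ->
  (forall w, \sum_(i <- s) \1_(A i) w <= \sum_(j <- t) \1_(B j) w :> R) ->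
  \sum_(i <- s) fine (P (A i)) <= \sum_(j <- t) fine (P (B j)).
Proof.
move=> mA mB AB.
have key (K : Type) (u : seq K) (C : K -> set T) : (forall k, measurable (C k)) ->
    (\sum_(k <- u) fine (P (C k)))%:E = (\int[P]_w (\sum_(k <- u) (\1_(C k) w)%:E))%E.
  move=> mC; rewrite ge0_integral_sum //; last first.
    by move=> k; apply/measurable_EFinP; exact: measurable_indic.
  rewrite -sumEFin; apply: eq_bigr => k _.
  by rewrite integral_indic // setIT fineK // fin_num_measure.
rewrite -lee_fin !key //; apply: ge0_le_integral => //.
- by move=> w _; exact: sume_ge0.
- by apply: emeasurable_sum => k; apply/measurable_EFinP; exact: measurable_indic.
- by apply: emeasurable_sum => k; apply/measurable_EFinP; exact: measurable_indic.
- by move=> w _; rewrite !sumEFin lee_fin.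
Qed.

End Countable.

Section Sigma.
Variables (d q : nat).
Implicit Types (V W : set (lattice d)) (A B : set (config d q)).

Lemma sigma_on_measurable V A : sigma_on V A -> measurable A.
Proof.
apply: sub_smallest2r; first exact: smallest_sigma_algebra.
by move=> C [x [s [_ ->]]]; exists x, s.
Qed.

Lemma sigma_on_agree V W (f : lattice d -> spin q) : W `<=` V ->
  sigma_on V [set w : config d q | forall z, W z -> w z = f z].
Proof.
move=> WV.
have := @bigcap_countable_measurable _ (g_sigma_algebraType (@cylinders d q V)) _ W
  (fun z => [set w : config d q | w z = f z]); apply => z Wz.
by apply: sub_sigma_algebra; exists z, (f z); split=> //; exact: WV.
Qed.

Lemma measurable_agree W (f : lattice d -> spin q) :
  measurable [set w : config d q | forall z, W z -> w z = f z].
Proof. by apply: (@sigma_on_measurable setT); exact: sigma_on_agree. Qed.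

(** Once the sites of V are overwritten by fixed values, an event depends only on
    the sites off V. *)
Lemma sigma_on_splice V (u : config d q) A : measurable A ->
  sigma_on (~` V) [set w | A (splice V u w)].
Proof.
pose X := [set B : set (config d q) | sigma_on (~` V) [set w | B (splice V u w)]].
suff : <<s @cylinders d q setT >> `<=` X by exact.
apply: smallest_sub.
  have [h0 hC hU] := smallest_sigma_algebra setT (@cylinders d q (~` V)).
  split; rewrite /X /=; first exact: h0.
  - by move=> B /hC; congr (sigma_on _ _); apply/seteqP; split.
  - by move=> F /hU; rewrite /sigma_on => h;
      rewrite (_ : mkset _ = \bigcup_n [set w | F n (splice V u w)]).
move=> _ [x [s [_ ->]]]; rewrite /X /=.
have [xV|xV] := pselect (V x).
  rewrite (_ : mkset _ = [set w | u x = s]); last first.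
    by apply/funext => w /=; rewrite splice_in.
  have [h0 hC hU] := smallest_sigma_algebra setT (@cylinders d q (~` V)).
  have [us|us] := pselect (u x = s).
    rewrite (_ : mkset _ = setT `\` set0); first exact: hC.
    by rewrite setD0; apply/seteqP; split.
  by rewrite (_ : mkset _ = set0) //; apply/seteqP; split.
rewrite (_ : mkset _ = [set w | w x = s]); last first.
  by apply/funext => w /=; rewrite splice_out.
by apply: sub_sigma_algebra; exists x, s.
Qed.

Lemma measurable_cluster (y : lattice d) :
  measurable [set w : config d q | cluster0 w y].
Proof.
rewrite (_ : mkset _ = \bigcup_(p in [set p : seq (lattice d) | path (@adj d) 0 p /\ last 0 p = y])
    [set w : config d q | forall z, z \in 0 :: p -> w z = spin1 q]).
  apply: bigcup_countable_measurable => p _.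
  exact: (@measurable_agree [set z | z \in 0 :: p] (fun=> spin1 q)).
apply/seteqP; split=> [w [p [pp lp Hp]]|w [p [pp lp] Hp]].
  by exists p.
by exists p; split.
Qed.

Lemma measurable_size_eq n : measurable (size_eq d q n).
Proof.
rewrite (_ : size_eq d q n = [set w | finite_set (cluster0 w) /\
  #|` fset_set (cluster0 w)|%fset = n]).
  apply: random_set_card_measurable; exact: measurable_cluster.
by apply/seteqP; split=> w /size_eqP.
Qed.

Variables (r : nat).
Implicit Types P : pattern d q r.

Lemma measurable_occ P x : measurable [set w : config d q | occ P w x].
Proof.
have [gx|gx] := pselect (grid d r x); last first.
  rewrite (_ : mkset _ = set0); first exact: measurable0.
  by apply/seteqP; split=> w // -[].
rewrite (_ : mkset _ =
  [set w : config d q | forall z, cube_at r x z -> w z = pattern_ext P (z - x)] `&`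
  \bigcap_(z in bd_at r x) [set w : config d q | cluster0 w z]).
  apply: measurableI; first exact: (measurable_agree _ (fun z => pattern_ext P (z - x))).
  by apply: bigcap_countable_measurable => z _; exact: measurable_cluster.
apply/seteqP; split=> w /=; first by case=> _ /occurs_onP[].
by move=> [h1 h2]; split=> //; apply/occurs_onP.
Qed.

Lemma measurable_joint_counts (d0 : (0 < d)%N) P P' n a b : measurable (joint_counts P P' n a b).
Proof.
rewrite (_ : joint_counts P P' n a b = size_eq d q n `&`
  [set w | finite_set (occ P w) /\ #|` fset_set (occ P w)|%fset = a] `&`
  [set w | finite_set (occ P' w) /\ #|` fset_set (occ P' w)|%fset = b]).
  by apply: measurableI; [apply: measurableI; first exact: measurable_size_eq|];
    apply: random_set_card_measurable; exact: measurable_occ.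
apply/seteqP; split=> [w [/[dup] wn /size_eqP[fC _] wa wb]|w [[wn [_ wa]] [_ wb]]].
  by split; [split=> //=|]; split=> //; exact: occ_finite.
by split.
Qed.

End Sigma.

(** * The probability of a switch *)
Section Prob.
Variables (R : realType) (d q : nat) (Pr : probability (config d q) R).
Notation pr A := (fine (Pr A)).

Lemma pr_ge0 A : 0 <= pr A.
Proof. exact: fine_ge0. Qed.

Lemma pr_le1 A : measurable A -> pr A <= 1.
Proof.
move=> mA; rewrite -lee_fin fineK ?fin_num_measure //; exact: probability_le1.
Qed.

Lemma pr_le A B : measurable A -> measurable B -> A `<=` B -> pr A <= pr B.
Proof.
by move=> mA mB AB; apply: fine_le; rewrite ?fin_num_measure //; apply: le_measure; rewrite ?inE.
Qed.

(** Given ones on the outer boundary of V, the inside and the outside are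
    independent; both products are equal to the product of the four separate
    factors. *)
Lemma markov_exchange V A A' B B' : boundary_markov (spin1 q) Pr -> finite_set V ->
  sigma_on V A -> sigma_on V A' ->
  sigma_on (~` (V `|` outer_bd V)) B -> sigma_on (~` (V `|` outer_bd V)) B' ->
  let E := all_in_state (spin1 q) (outer_bd V) in
  pr (A `&` B `&` E) * pr (A' `&` B' `&` E) = pr (A' `&` B `&` E) * pr (A `&` B' `&` E).
Proof.
move=> hM fV sA sA' sB sB' E.
have mE : measurable E by exact: (measurable_agree (outer_bd V) (fun=> spin1 q)).
have mV C : sigma_on V C -> measurable C by exact: sigma_on_measurable.
have mN C : sigma_on (~` (V `|` outer_bd V)) C -> measurable C by exact: sigma_on_measurable.
have [E0|E0] := eqVneq (pr E) 0.
  have z C D : measurable C -> measurable D -> pr (C `&` D `&` E) = 0.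
    move=> mC mD; apply/eqP; rewrite eq_le pr_ge0 andbT -E0.
    by apply: pr_le => //; do 2 apply: measurableI => //.
  by rewrite !z ?mul0r; auto.
have key C D : sigma_on V C -> sigma_on (~` (V `|` outer_bd V)) D ->
    pr (C `&` D `&` E) = pr (C `&` E) * pr (D `&` E) / pr E.
  move=> sC sD; have := hM V fV C D sC sD; rewrite /cond_pr -/E => h.
  apply: (mulIf (invr_neq0 E0)); rewrite h; ring.
by rewrite !key //; ring.
Qed.

(** Finite energy bounds from below, by h, the conditional probability of each
    prescribed state given the others, and the sites can be treated one by one. *)
Lemma prob_agree_gt0 : finite_energy Pr -> forall (s : seq (lattice d)) f,
  0 < pr [set w : config d q | forall z, [set` s] z -> w z = f z].
Proof.
case=> h [/andP[h0 h1] hg] s f; elim: s => [|x s IH].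
  rewrite (_ : mkset _ = setT); last by apply/seteqP; split.
  by rewrite probability_setT.
have [xs|xs] := boolP (x \in s).
  rewrite (_ : mkset _ = [set w : config d q | forall z, [set` s] z -> w z = f z]) //.
  apply/seteqP; split=> w hw z zs; apply: hw => /=; first by rewrite inE [_ \in s]zs orbT.
  by move: zs; rewrite /= inE => /orP[/eqP->|].
set B := [set w : config d q | _] in IH.
have sB : sigma_on [set~ x] B.
  by apply: sigma_on_agree => z zs /= zx; move: xs; rewrite -zx zs.
have mB := sigma_on_measurable sB.
have [g [[mg gB] gh]] := hg x (f x).
have -> : [set w : config d q | forall z, [set` x :: s] z -> w z = f z] =
    [set w | w x = f x] `&` B.
  apply/seteqP; split=> [w hw|w [wx wB] z /=].
    by split=> [|z zs]; apply: hw; rewrite /= inE ?eqxx // [_ \in s]zs orbT.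
  by rewrite inE => /orP[/eqP->|/wB].
apply: (@lt_le_trans _ _ (h * pr B)); first exact: mulr_gt0.
have mA : measurable [set w : config d q | w x = f x].
  rewrite (_ : mkset _ = [set w : config d q | forall z, [set x] z -> w z = f z]).
    exact: measurable_agree.
  by apply/seteqP; split=> [w wx z ->|w] //; apply.
rewrite -lee_fin EFinM !fineK ?fin_num_measure //; last exact: measurableI.
rewrite gB // -integral_cst //; apply: ge0_le_integral => //.
- by move=> w _; rewrite lee_fin ltW.
- apply/measurable_EFinP; apply: measurable_funTS => _ Y mY; rewrite setTI.
  by apply: sigma_on_measurable; exact: mg.
- by move=> w _; rewrite lee_fin; case/andP: (gh w).
Qed.

Section Pattern.
Variables (r : nat) (hinv : translation_invariant Pr).
Variables (hmarkov : boundary_markov (spin1 q) Pr) (hfe : finite_energy Pr).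
Hypothesis d2 : (2 <= d)%N.
Implicit Types P : pattern d q r.

Definition boxed_at P (x : lattice d) : set (config d q) :=
  [set w | (forall z, cube_at r x z -> w z = pattern_ext P (z - x)) /\
           (forall z, bd_at r x z -> w z = spin1 q)].

Lemma boxed_at0 P : boxed P = boxed_at P 0.
Proof.
apply/seteqP; split=> w [h1 h2]; split.
- move=> z; rewrite /cube_at /= subr0 => /cubeE[y <-]; by rewrite pattern_extE h1.
- by move=> z; rewrite /bd_at /= subr0 => /h2.
- by move=> y; rewrite h1 ?subr0 ?pattern_extE // /cube_at /= subr0; exact: cube_val.
- by move=> z bz; apply: h2; rewrite /bd_at /= subr0.
Qed.

Lemma measurable_boxed_at P x : measurable (boxed_at P x).
Proof.
apply: measurableI; first exact: (measurable_agree _ (fun z => pattern_ext P (z - x))).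
exact: (measurable_agree _ (fun=> spin1 q)).
Qed.

Lemma pr_boxed_at P x : pr (boxed_at P x) = pr (boxed P).
Proof.
rewrite boxed_at0 -(hinv x (measurable_boxed_at P 0)); congr (fine (Pr _)).
apply/seteqP; split=> w [h1 h2]; split.
- by move=> z; rewrite /cube_at /= !subr0 => zV; rewrite h1 /cube_at /= addrK.
- by move=> z; rewrite /bd_at /= !subr0 => zV; rewrite h2 // /bd_at /= addrK.
- by move=> z zV; rewrite -{1}(subrK x z) h1 /cube_at /= ?subr0.
- by move=> z zV; rewrite -{1}(subrK x z) h2 // /bd_at /= ?subr0.
Qed.

Lemma pr_boxed_gt0 P : 0 < pr (boxed P).
Proof.
rewrite boxed_at0.
have fe : finite_set (cube_ext d r).
  apply: sub_finite_set (finite_box d r.+1) => y ye i; have := ye i; lia.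
pose f z := if z \in cube d r then pattern_ext P z else spin1 q.
rewrite (_ : boxed_at P 0 = [set w : config d q |
    forall z, [set` enum_fset (fset_set (cube_ext d r))] z -> w z = f z]).
  exact: prob_agree_gt0.
have e z : (z \in enum_fset (fset_set (cube_ext d r))) <-> cube_ext d r z.
  by split=> [|ze]; [rewrite in_fset_set // => /set_mem|rewrite in_fset_set // mem_set].
apply/seteqP; split=> w.
  move=> [h1 h2] z /= /e ze; rewrite /f.
  case: ifPn => [/set_mem zQ|/negP zQ]; first by rewrite h1 /cube_at /= subr0.
  by apply: h2; rewrite /bd_at /= subr0; split=> // zQ'; apply: zQ; rewrite mem_set.
move=> hw; split=> z; rewrite /bd_at /cube_at /= subr0 => zV.
  rewrite hw /f ?mem_set //; apply/e => i; have := zV i; lia.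
case: zV => ze zQ; rewrite hw /f ?memNset //; exact/e.
Qed.

Lemma cube_at_finite x : finite_set (@cube_at d r x).
Proof.
apply: (@sub_finite_set _ _ ((fun z => z + x) @` cube d r)).
  by move=> z zV; exists (z - x) => //; exact: subrK.
exact/finite_image/cube_finite.
Qed.

Variables (P P' : pattern d q r) (PP' : P <> P').

Let d0 : (0 < d)%N. Proof. exact: ltnW. Qed.

(** Both events, and both boxed patterns, are the intersection of a pattern in
    the cube, ones on the outer boundary of the cube, and an event outside.  The
    outside events before and after the switch coincide, because overwriting the
    cube and its outer boundary turns [switch_event] into an equivalence; the
    outside event of both boxed patterns is that the rest of the cube boundary is
    occupied. *)
Lemma switch_prob x n a b :
  pr (joint_counts P P' (n + cpat P) a.+1 b `&` [set w | occ P w x]) * pr (boxed P') =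
  pr (joint_counts P P' (n + cpat P') a b.+1 `&` [set w | occ P' w x]) * pr (boxed P).
Proof.
set V := @cube_at d r x; pose N := outer_bd V; pose E := all_in_state (q := q) (spin1 q) N.
have Nbd : N `<=` bd_at r x.
  by move=> z [y yV [yz zV]]; exact: cube_at_nbr yV yz zV.
have NV z : N z -> ~ V z by move=> /Nbd; exact: bd_at_out.
pose A (T : pattern d q r) := [set w : config d q | forall z, V z -> w z = pattern_ext T (z - x)].
pose u (T : pattern d q r) : config d q :=
  fun z => if z \in V then pattern_ext T (z - x) else spin1 q.
have uV T w z : V z -> splice (V `|` N) (u T) w z = pattern_ext T (z - x).
  by move=> Vz; rewrite splice_in; [rewrite /u mem_set|left].
have uN T w z : N z -> splice (V `|` N) (u T) w z = spin1 q.
  by move=> Nz; rewrite splice_in; [rewrite /u memNset //; exact: NV|right].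
have uA T w : A T w -> E w -> splice (V `|` N) (u T) w = w.
  move=> Aw Ew; apply/funext => z; have [Vz|Vz] := pselect (V z).
    by rewrite uV // Aw.
  have [Nz|Nz] := pselect (N z); first by rewrite uN // Ew.
  by rewrite splice_out // => -[].
set F := (X in pr X * _ = _); set F' := (X in _ = pr X * _).
have mF : measurable F by apply: measurableI; [exact: measurable_joint_counts|exact: measurable_occ].
pose B := [set w | F (splice (V `|` N) (u P) w)].
have BB' : B = [set w | F' (splice (V `|` N) (u P') w)].
  apply/seteqP; split=> w /=.
    apply: switch_event => // z Vz; first exact: uV.
    have [Nz|Nz] := pselect (N z); first by rewrite !uN.
    by rewrite !splice_out // => -[].
  have sw n' a' b' : joint_counts P P' n' a' b' = joint_counts P' P n' b' a'.
    by apply/seteqP; split=> v [].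
  rewrite /B /F /F' /= !(sw _ _ b) !(sw _ _ b.+1).
  apply: switch_event => //; [exact: nesym|exact: uV|] => z Vz.
  have [Nz|Nz] := pselect (N z); first by rewrite !uN.
  by rewrite !splice_out // => -[].
have FE : F = A P `&` B `&` E.
  apply/seteqP; split=> w.
    move=> Fw; have [_ [_ /occurs_onP[wA wb]]] := Fw.
    have wE : E w by move=> z /Nbd /wb /conn_r.
    by split=> //; split=> //; rewrite /B /= uA.
  by case=> [[wA]]; rewrite /B /= => + wE; rewrite uA.
have F'E : F' = A P' `&` B `&` E.
  rewrite BB'; apply/seteqP; split=> w.
    move=> Fw; have [_ [_ /occurs_onP[wA wb]]] := Fw.
    have wE : E w by move=> z /Nbd /wb /conn_r.
    by split=> //; split=> //=; rewrite uA.
  by case=> [[wA]] /= + wE; rewrite uA.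
pose B0 := [set w : config d q | forall z, (bd_at r x `\` N) z -> w z = spin1 q].
have BXE T : boxed_at T x = A T `&` B0 `&` E.
  apply/seteqP; split=> w.
    move=> [h1 h2]; split; last by move=> z /Nbd; exact: h2.
    by split=> // z [bz _]; exact: h2.
  move=> [[h1 h2] h3]; split=> // z bz.
  by have [Nz|Nz] := pselect (N z); [exact: h3|exact: h2].
rewrite -(pr_boxed_at P x) -(pr_boxed_at P' x) !BXE FE F'E.
apply: markov_exchange => //.
- exact: cube_at_finite.
- exact: (@sigma_on_agree _ _ _ _ (fun z => pattern_ext P (z - x))).
- exact: (@sigma_on_agree _ _ _ _ (fun z => pattern_ext P' (z - x))).
- exact: sigma_on_splice.
- apply: (@sigma_on_agree _ _ _ _ (fun=> spin1 q)) => z [bz Nz] [Vz|//].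
  exact: bd_at_out bz Vz.
Qed.

End Pattern.
End Prob.

(** * The switching identity and its iteration *)
Section Iterate.
Variables (R : realType) (d q : nat) (Pr : probability (config d q) R).
Notation pr A := (fine (Pr A)).
Variables (r : nat) (hinv : translation_invariant Pr).
Variables (hmarkov : boundary_markov (spin1 q) Pr) (hfe : finite_energy Pr).
Hypothesis d2 : (2 <= d)%N.
Variables (P P' : pattern d q r) (PP' : P <> P').

Let d0 : (0 < d)%N. Proof. exact: ltnW. Qed.

Lemma sum_pr_occ (T : pattern d q r) (X : seq (lattice d)) (F : set (config d q)) k :
  uniq X -> measurable F ->
  (forall w, F w -> [/\ finite_set (occ T w), occ T w `<=` [set` X] & npat T w = k]) ->
  \sum_(x <- X) pr (F `&` [set w | occ T w x]) = k%:R * pr F.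
Proof.
move=> uX mF HF.
have sumF w : \sum_(x <- X) \1_(F `&` [set v | occ T v x]) w =
    \sum_(x <- nseq k tt) \1_F w :> R.
  rewrite big_const_seq count_predT size_nseq -Monoid.iteropE /= -[RHS]mulr_natl.
  have [Fw|Fw] := pselect (F w); last first.
    rewrite indicE memNset // mulr0 big1 // => x _.
    by rewrite indicE memNset // => -[].
  have [fo oX <-] := HF w Fw; rewrite indicE mem_set // mulr1.
  rewrite (eq_bigr (fun x => (x \in fset_set (occ T w))%:R)); last first.
    move=> x _; rewrite indicE in_fset_set //; congr (nat_of_bool _)%:R.
    by apply/idP/idP => /set_mem; [case=> _ ?|move=> ?]; rewrite mem_set.
  rewrite -natr_sum; congr _%:R.
  rewrite (eq_bigr (fun x => if x \in fset_set (occ T w) then 1 else 0)%N); last first.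
    by move=> x _; case: (_ \in _).
  rewrite -big_mkcond /= sum1_count -size_filter npatE.
  apply/perm_size/uniq_perm; rewrite ?filter_uniq ?fset_uniq // => x.
  rewrite mem_filter; case: (boolP (x \in fset_set _)) => //= xo.
  by apply: oX; apply/set_mem; rewrite -in_fset_set.
have mo x : measurable (F `&` [set w | occ T w x]).
  by apply: measurableI => //; exact: measurable_occ.
rewrite (_ : k%:R * _ = \sum_(x <- nseq k tt) pr F); last first.
  by rewrite big_const_seq count_predT size_nseq -Monoid.iteropE /= mulr_natl.
by apply/eqP; rewrite eq_le; apply/andP; split;
  apply: (sum_prob_le Pr) => // w; rewrite sumF.
Qed.

(** Sum [switch_prob] over the sites x of a box that contains all occurrences:
    a configuration is counted once for each occurrence of P before the switch,
    and once for each occurrence of P' after it. *)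
Lemma switch_identity n a b :
  a.+1%:R * pr (joint_counts P P' (n + cpat P) a.+1 b) * pr (boxed P') =
  b.+1%:R * pr (joint_counts P P' (n + cpat P') a b.+1) * pr (boxed P).
Proof.
pose box := [set y : lattice d | forall i, `|y 0 i| <= (n + cpat P + cpat P').+1%:Z].
have fb : finite_set box by exact: finite_box.
pose X := enum_fset (fset_set box).
have HF (T : pattern d q r) n' a' b' k : (n' <= n + cpat P + cpat P')%N ->
    (forall w, joint_counts P P' n' a' b' w -> npat T w = k) ->
    \sum_(x <- X) pr (joint_counts P P' n' a' b' `&` [set w | occ T w x]) =
    k%:R * pr (joint_counts P P' n' a' b').
  move=> n'n Hk; apply: sum_pr_occ; [exact: fset_uniq|exact: measurable_joint_counts|].
  move=> w Fw; split; [|move=> x ox|exact: Hk].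
    by case: Fw => /size_eqP[fC _] _ _; exact: occ_finite.
  rewrite /= in_fset_set // mem_set // => i.
  by case: Fw => wn _ _; have := occ_box d0 wn ox i; lia.
rewrite -(HF P) ?leq_addr //; last by move=> w [].
rewrite -(HF P') //; [|by rewrite addnAC leq_addr|by move=> w []].
by rewrite !mulr_suml; apply: eq_bigr => x _; exact: switch_prob.
Qed.

Let rho := pr (boxed P) / pr (boxed P').

Lemma rho_gt0 : 0 < rho.
Proof. by apply: divr_gt0; exact: pr_boxed_gt0. Qed.

(** The i-th switch multiplies the probability by rho (b+i) / (a+j+1-i), which the
    hypothesis bounds by theta for all i <= j at once. *)
Lemma iterated_switch_le (theta : R) j n a b : 0 <= theta ->
  rho * (b + j)%:R <= theta * a%:R ->
  pr (joint_counts P P' (n + j * cpat P) (a + j) b) <=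
  theta ^+ j * pr (joint_counts P P' (n + j * cpat P') a (b + j)).
Proof.
move=> t0; elim: j n b => [|j IH] n b ab; first by rewrite !mul0n !addn0 mul1r.
have := switch_identity (n + j * cpat P) (a + j) b.
rewrite (_ : n + j * cpat P + cpat P = n + j.+1 * cpat P)%N; last by rewrite mulSn; lia.
rewrite (_ : n + j * cpat P + cpat P' = n + cpat P' + j * cpat P)%N; last lia.
have := IH (n + cpat P')%N b.+1; rewrite addSnnS => /(_ ab).
rewrite (_ : n + cpat P' + j * cpat P' = n + j.+1 * cpat P')%N; last by rewrite mulSn; lia.
rewrite addnS; set x := pr _; set y := pr _ => yx.
set z := pr (joint_counts _ _ _ _ b) => zE.
have {zE} zE : z = rho * b.+1%:R / (a + j).+1%:R * x.
  have B0 : pr (boxed P') != 0 by apply/lt0r_neq0/pr_boxed_gt0.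
  have A0 : (a + j).+1%:R != 0 :> R by rewrite pnatr_eq0.
  apply: (mulfI A0); apply: (mulIf B0); rewrite zE /rho; field.
  by rewrite B0 andbT addrC -natrD natr1.
have x0 : 0 <= x by exact: pr_ge0.
have le : rho * b.+1%:R / (a + j).+1%:R <= theta.
  rewrite ler_pdivrMr ?ltr0n //; apply: (le_trans _ (le_trans ab _)).
    by apply: ler_wpM2l; [exact/ltW/rho_gt0|rewrite ler_nat; lia].
  by apply: ler_wpM2l => //; rewrite ler_nat; lia.
rewrite addnS -/z zE exprS -[leRHS]mulrA; apply: ler_pM => //.
by apply: mulr_ge0; [apply: mulr_ge0; [exact/ltW/rho_gt0|]|rewrite invr_ge0].
Qed.

Lemma measurable_npat_event n (D : nat -> nat -> Prop) :
  measurable ([set w : config d q | D (npat P w) (npat P' w)] `&` size_eq d q n).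
Proof.
rewrite (_ : _ `&` _ = \bigcup_(i in [set i : nat * nat | D i.1 i.2]) joint_counts P P' n i.1 i.2).
  by apply: bigcup_countable_measurable => i _; exact: measurable_joint_counts.
apply/seteqP; split=> [w [Dw wn]|w [[i1 i2] Di [/= wn wi1 wi2]]] //; last by rewrite /= wi1 wi2.
by exists (npat P w, npat P' w).
Qed.

(** Different pairs of counts remain different after the j switches, so that the
    bounds for the separate pairs add up to a single probability. *)
Lemma switched_event_le (theta : R) j n (D : nat -> nat -> Prop) : 0 <= theta ->
  (forall a b, (a <= n + j * cpat P)%N -> D a b ->
     (j <= a)%N /\ rho * (b + j)%:R <= theta * (a - j)%:R) ->
  pr ([set w | D (npat P w) (npat P' w)] `&` size_eq d q (n + j * cpat P)) <=
  theta ^+ j * pr (size_eq d q (n + j * cpat P')).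
Proof.
move=> t0 HD; set m := (n + j * cpat P)%N; set m' := (n + j * cpat P')%N.
pose s := enum [pred i : 'I_m.+1 * 'I_m.+1 | rho * (i.2 + j)%:R <= theta * (i.1 : nat)%:R].
apply: (@le_trans _ _ (\sum_(i <- s) pr (joint_counts P P' m (i.1 + j) i.2))).
  rewrite -[leLHS](big_seq1 +%R tt (fun=>
    pr ([set w | D (npat P w) (npat P' w)] `&` size_eq d q m))).
  apply: sum_prob_le.
  - by move=> _; exact: measurable_npat_event.
  - by move=> i; exact: measurable_joint_counts.
  move=> w; rewrite big_seq1 [leLHS]indicE.
  case: (boolP (w \in _)) => [/set_mem[Dw wn]|_]; last exact: sumr_ge0.
  have am := npat_le P d0 wn; have bm := npat_le P' d0 wn.
  have [ja ab] := HD _ _ am Dw.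
  have am' : (npat P w - j < m.+1)%N by lia.
  pose i0 : 'I_m.+1 * 'I_m.+1 := (Ordinal am', Ordinal (bm : (npat P' w < m.+1)%N)).
  rewrite (big_rem i0) /=; last by rewrite mem_enum inE.
  rewrite indicE mem_set /=; last by split=> //=; rewrite subnK.
  by rewrite lerDl sumr_ge0.
apply: (@le_trans _ _ (theta ^+ j * \sum_(i <- s) pr (joint_counts P P' m' i.1 (i.2 + j)))).
  rewrite mulr_sumr big_seq [leRHS]big_seq; apply: ler_sum => i.
  by rewrite mem_enum inE => /iterated_switch_le; exact.
apply: ler_wpM2l; first exact: exprn_ge0.
rewrite -[leRHS](big_seq1 +%R tt (fun=> pr (size_eq d q m'))); apply: sum_prob_le.
- by move=> i; exact: measurable_joint_counts.
- by move=> _; exact: measurable_size_eq.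
move=> w; rewrite big_seq1.
have [[i0 [i0s wi0]]|H] := pselect (exists i0, i0 \in s /\ joint_counts P P' m' i0.1 (i0.2 + j) w).
  rewrite (bigD1_seq i0) ?enum_uniq //= big1 ?addr0; last first.
    move=> i /eqP ii0; rewrite indicE memNset //; case=> _ e1 e2; apply: ii0.
    case: wi0 => _; rewrite e1 e2 => h1 /eqP; rewrite eqn_add2r => /eqP h2.
    by case: i i0 h1 h2 {i0s e1 e2} => [i1 i2] [k1 k2] /= h1 h2; congr pair; exact: val_inj.
  by rewrite !indicE !mem_set //; case: wi0.
rewrite big1_seq // => i /andP[_ is_]; rewrite indicE memNset // => wi.
by apply: H; exists i.
Qed.

End Iterate.

(** * Exponential asymptotics *)
Section Asymptotics.
Variable R : realType.
Implicit Types (a b c M : R) (u v : nat -> R).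

Lemma near_ge1 : \forall n \near \oo, (1 <= n%:R :> R).
Proof. exact: nbhs_infty_ger. Qed.

Lemma powR_near_ge a M : 0 < a -> \forall n \near \oo, M <= n%:R `^ a.
Proof.
move=> a0; pose m := `|M| + 1.
have m0 : 0 <= m by rewrite addr_ge0.
near=> n; apply: (@le_trans _ _ m); first by rewrite /m (le_trans (ler_norm _)) // lerDl.
rewrite -[m]powRr1 // -[X in m `^ X](mulVf (lt0r_neq0 a0)) powRrM.
apply: ge0_ler_powR; rewrite ?nnegrE ?powR_ge0 ?ler0n ?(ltW a0) //.
near: n; exact: nbhs_infty_ger.
Unshelve. all: by end_near. Qed.

Lemma limn_esup_lt1 u c : c < 1 -> (\forall n \near \oo, u n <= c) ->
  (limn_esup (fun n => (u n)%:E) < 1)%E.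
Proof.
move=> c1 [N _ HN]; apply: (@le_lt_trans _ _ c%:E); last by rewrite lte_fin.
rewrite /limn_esup limf_esupE; apply: ereal_inf_le.
exists (ereal_sup [set (u n)%:E | n in [set n | (N <= n)%N]]).
  by exists [set n | (N <= n)%N] => //; exists N.
by apply: ge_ereal_sup => _ [n Nn <-]; rewrite lee_fin; exact: HN.
Qed.

(** Half of the exponential rate absorbs the constant K. *)
Lemma limn_esup_root_lt1 u a c K : 0 < a -> 0 < c ->
  (forall n, 0 <= u n) ->
  (\forall n \near \oo, u n <= K * expR (- c * n%:R `^ a)) ->
  (limn_esup (fun n => (u n `^ (n%:R `^ a)^-1)%:E) < 1)%E.
Proof.
move=> a0 c0 u0 Hu; apply: (@limn_esup_lt1 _ (expR (- (c / 2)))).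
  by rewrite -expR0 ltr_expR oppr_lt0 divr_gt0.
near=> n; set t := n%:R `^ a.
have t0 : 0 < t by apply: powR_gt0; apply: (lt_le_trans ltr01); near: n; exact: near_ge1.
have Kt : K <= expR (c / 2 * t).
  apply: le_trans (expR_ge1Dx _); rewrite -lerBlDl mulrC -ler_pdivrMr ?divr_gt0 //.
  by rewrite /t; near: n; exact: powR_near_ge.
have ut : u n <= expR (- (c / 2) * t).
  apply: (@le_trans _ _ (K * expR (- c * t))); first by rewrite /t; near: n.
  rewrite (_ : - (c / 2) * t = c / 2 * t + - c * t); last by field.
  by rewrite expRD ler_wpM2r // expR_ge0.
apply: (@le_trans _ _ (expR (- (c / 2) * t) `^ t^-1)).
  by apply: ge0_ler_powR; rewrite ?nnegrE ?invr_ge0 ?expR_ge0 ?(ltW t0).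
by rewrite -expRM mulfK // lt0r_neq0.
Unshelve. all: by end_near. Qed.

Lemma root_cvg_bounds u v (l delta : R) : (forall n, 0 <= u n) -> (forall n, 0 <= v n) ->
  (\forall n \near \oo, 0 < v n) -> 0 < l -> 0 < delta ->
  (fun n => u n `^ (v n)^-1) @ \oo --> l ->
  \forall n \near \oo, expR ((ln l - delta) * v n) <= u n <= expR ((ln l + delta) * v n).
Proof.
move=> u0 v0 v_gt0 l0 d0 ul.
have lD : l < expR (ln l + delta) by rewrite -{1}(lnK l0) ltr_expR ltrDl.
have lB : expR (ln l - delta) < l by rewrite -{2}(lnK l0) ltr_expR gtrDl oppr_lt0.
near=> n.
have vn : 0 < v n by near: n.
have e : u n = (u n `^ (v n)^-1) `^ v n by rewrite -powRrM mulVf ?powRr1 // lt0r_neq0.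
rewrite e !expRM; apply/andP; split; apply: ge0_ler_powR;
  rewrite ?nnegrE ?powR_ge0 ?expR_ge0 ?(ltW vn) //; apply: ltW; near: n.
- exact: cvgr_gt ul _ lB.
- exact: cvgr_lt ul _ lD.
Unshelve. all: by end_near. Qed.

End Asymptotics.

(** * Exponential cost of an excess of one pattern *)
Section Swap.
Variables (R : realType) (d q : nat) (Pr : probability (config d q) R).
Notation pr A := (fine (Pr A)).
Variables (r : nat) (hinv : translation_invariant Pr).
Variables (hmarkov : boundary_markov (spin1 q) Pr) (hfe : finite_energy Pr).
Hypothesis d2 : (2 <= d)%N.

(** For alpha <= 1, this is [switched_event_le] with
    theta = exp(- eps n^(alpha-1) / 2) and j = floor(eta n^alpha).  The lower
    bound on n' is what part (ii) requires in order to compare Pr(|C| = n') with Pr(|C| = n). *)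
Lemma excess_bound (P P' : pattern d q r) (alpha eps : R) : P <> P' ->
  0 < alpha -> 0 < eps ->
  let rho := pr (boxed P) / pr (boxed P') in
  exists2 c, 0 < c & \forall n \near \oo, exists n',
    [/\ n%:R - n%:R `^ alpha <= n'%:R :> R, cpat P = cpat P' -> n' = n
      & pr ([set w | (rho * (npat P' w)%:R + eps * n%:R `^ alpha <= (npat P w)%:R)%R]
            `&` size_eq d q n)
        <= expR (- c * n%:R `^ (2 * alpha - 1)) * pr (size_eq d q n')].
Proof.
move=> PP' a0 e0 rho.
have rho0 : 0 < rho by exact: rho_gt0.
have [a1|a1] := ltP 1 alpha.
  (* N_P <= n, so the event is empty once eps n^alpha > n *)
  exists 1; rewrite ?ltr01 //; near=> n; exists n; split=> //.
    by rewrite lerBlDr lerDl powR_ge0.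
  rewrite (_ : _ `&` _ = set0); last first.
    apply/seteqP; split=> // w [/= Dw wn].
    have := npat_le P (ltnW d2) wn; rewrite -(ler_nat R) => /(le_trans Dw).
    have n1 : 1 <= n%:R :> R by near: n; exact: near_ge1.
    have n0 : 0 < n%:R :> R by apply: lt_le_trans n1.
    have -> : n%:R `^ alpha = n%:R * n%:R `^ (alpha - 1).
      by rewrite -{2}[n%:R]powRr1 ?(ltW n0) // -powRD ?(lt0r_neq0 n0) ?implybT // addrC subrK.
    have : (eps^-1 + 1) <= n%:R `^ (alpha - 1).
      by near: n; apply: powR_near_ge; rewrite subr_gt0.
    set z := _ `^ _ => hz; have : 1 < eps * z.
      rewrite -ltr_pdivrMl // mulr1; apply: lt_le_trans hz; by rewrite ltrDl.
    have : 0 <= rho * (npat P' w)%:R by rewrite mulr_ge0 // ltW.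
    move: (rho * _) => y; move: (n%:R) n0 => x x0 y0 h1 h2.
    have : x * 1 < x * (eps * z) by rewrite ltr_pM2l.
    by clear PP'; move: h2; rewrite mulrCA; lra.
  by rewrite measure0 mulr_ge0 ?expR_ge0 ?pr_ge0.
(* the first bound keeps an excess of eps n^alpha / 2 after j switches; the
   second one ensures j c_P <= n^alpha <= n *)
pose eta := Num.min (eps / (2 * (1 + rho))) ((cpat P).+1%:R^-1).
have r1 : 0 < 1 + rho by rewrite addr_gt0.
have eta0 : 0 < eta by rewrite lt_min divr_gt0 ?mulr_gt0 //= invr_gt0.
have eta1 : eta * (1 + rho) <= eps / 2.
  rewrite -ler_pdivlMr // ge_min; apply/orP; left.
  by rewrite invfM mulrA.
have eta2 : eta * (cpat P)%:R <= 1.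
  apply: (@le_trans _ _ ((cpat P).+1%:R^-1 * (cpat P)%:R)).
    by rewrite ler_wpM2r // ge_min lexx orbT.
  by rewrite ler_pdivrMl // mulr1 ler_nat.
exists (eps * eta / 4); first by rewrite divr_gt0 ?mulr_gt0.
near=> n.
have n1 : 1 <= n%:R :> R by near: n; exact: near_ge1.
have n0 : 0 < n%:R :> R by apply: lt_le_trans n1.
set y := n%:R `^ alpha; pose z := n%:R `^ (alpha - 1).
have y0 : 0 < y by exact: powR_gt0.
have z0 : 0 < z by exact: powR_gt0.
have yz : y = n%:R * z.
  by rewrite -{1}[n%:R]powRr1 ?(ltW n0) // -powRD ?(lt0r_neq0 n0) ?implybT // addrC subrK.
have yn : y <= n%:R by rewrite -[leRHS]powRr1 ?(ltW n0) //; exact: ler_powR.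
have zy : n%:R `^ (2 * alpha - 1) = z * y.
  by rewrite /z /y -powRD ?(lt0r_neq0 n0) ?implybT //; congr (_ `^ _); ring.
have etay : 2 <= eta * y.
  by rewrite -ler_pdivrMl // /y; near: n; exact: powR_near_ge.
pose j := Num.truncn (eta * y).
have etay0 : 0 <= eta * y by rewrite ltW ?mulr_gt0.
have jle : j%:R <= eta * y by rewrite truncn_le.
have jge : eta * y / 2 <= j%:R.
  have := truncnS_gt (eta * y); rewrite -/j -natr1; clear PP'; lra.
have jc : (j * cpat P <= n)%N.
  rewrite -(ler_nat R) natrM; apply: le_trans yn.
  apply: (@le_trans _ _ (eta * y * (cpat P)%:R)); first by rewrite ler_wpM2r.
  by rewrite mulrAC -[leRHS]mul1r ler_wpM2r // ltW.
have nE : n = (n - j * cpat P + j * cpat P)%N by rewrite subnK.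
exists (n - j * cpat P + j * cpat P')%N; split.
- apply: (@le_trans _ _ (n - j * cpat P)%:R); last by rewrite ler_nat leq_addr.
  rewrite natrB // lerD2l lerN2 natrM.
  apply: (@le_trans _ _ (eta * y * (cpat P)%:R)); first by rewrite ler_wpM2r.
  by rewrite mulrAC -[leRHS]mul1r ler_wpM2r // ltW.
- by move=> <-; rewrite -nE.
pose theta := expR (- (eps * z / 2)).
apply: (@le_trans _ _ (theta ^+ j * pr (size_eq d q (n - j * cpat P + j * cpat P')))); last first.
  rewrite ler_wpM2r ?pr_ge0 // /theta -expRM_natr ler_expR zy.
  rewrite !mulNr lerN2.
  have : (eps * z / 2) * (eta * y / 2) <= eps * z / 2 * j%:R.
    by rewrite ler_wpM2l // divr_ge0 // mulr_ge0 // ltW.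
  by apply: le_trans; rewrite le_eqVlt; apply/orP; left; apply/eqP; field.
have := @switched_event_le R d q Pr r hinv hmarkov hfe d2 P P' PP' theta j
  (n - j * cpat P) (fun a b => (rho * b%:R + eps * y <= a%:R)%R) (expR_ge0 _).
rewrite -nE; apply => a b an ab.
have b0 : 0 <= rho * b%:R by rewrite mulr_ge0 // ltW.
have rj : (1 + rho) * j%:R <= eps * y / 2.
  apply: (@le_trans _ _ ((1 + rho) * (eta * y))); first by rewrite ler_wpM2l // ltW.
  have -> : (1 + rho) * (eta * y) = eta * (1 + rho) * y by ring.
  by rewrite [leRHS]mulrAC ler_wpM2r // ltW.
have ja : (j <= a)%N.
  rewrite -(ler_nat R); have : 0 <= rho * j%:R by rewrite mulr_ge0 // ltW.
  have : 0 < eps * y by rewrite mulr_gt0.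
  clear PP'; lra.
split=> //; apply: (@le_trans _ _ ((1 - eps * z / 2) * (a - j)%:R)); last first.
  by rewrite ler_wpM2r // (le_trans _ (expR_ge1Dx _)).
have an' : eps * z / 2 * (a - j)%:R <= eps * y / 2.
  rewrite yz (_ : eps * (n%:R * z) / 2 = eps * z / 2 * n%:R); last by ring.
  rewrite ler_wpM2l ?divr_ge0 ?mulr_ge0 ?(ltW e0) ?(ltW z0) // ler_nat.
  exact: leq_trans (leq_subr _ _) an.
rewrite -/rho mulrBl mul1r natrD mulrDr; move: an' ab rj.
rewrite natrB // [(1 + rho) * _]mulrDl mul1r.
set A := eps * z / 2 * _; set B := eps * y; move: (rho * _) (rho * _) => u v.
clear; lra.
Unshelve. all: by end_near. Qed.

End Swap.

(** * The two parts of the theorem *)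
Section Final.
Variables (R : realType) (d q : nat) (Pr : probability (config d q) R).
Notation pr A := (fine (Pr A)).

Lemma gamma_ratio_equal r mu (P P' : pattern d q r) : 0 < mu -> cpat P = cpat P' ->
  gamma_ratio Pr mu P P' = pr (boxed P) / pr (boxed P').
Proof.
move=> mu0 c; rewrite /gamma_ratio c -mulf_div divff ?mul1r //.
by rewrite expf_neq0 // lt0r_neq0.
Qed.

Lemma gamma_ratio1 r (P P' : pattern d q r) :
  gamma_ratio Pr 1 P P' = pr (boxed P) / pr (boxed P').
Proof. by rewrite /gamma_ratio !expr1n !mul1r. Qed.

Lemma cond_pr_le (A E : set (config d q)) (t : R) :
  0 <= t -> pr (A `&` E) <= t * pr E -> cond_pr Pr A E <= t.
Proof.
move=> t0 h; rewrite /cond_pr.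
have [->|E0] := eqVneq (pr E) 0; first by rewrite invr0 mulr0.
by rewrite ler_pdivrMr // lt_neqAle eq_sym E0 pr_ge0.
Qed.

Lemma cond_pr_ge0 (A E : set (config d q)) : 0 <= cond_pr Pr A E.
Proof. by rewrite /cond_pr divr_ge0 ?pr_ge0. Qed.

Variables (r : nat) (hinv : translation_invariant Pr).
Variables (hmarkov : boundary_markov (spin1 q) Pr) (hfe : finite_energy Pr).
Hypothesis d2 : (2 <= d)%N.

Lemma equal_size_case (P P' : pattern d q r) (alpha eps rho : R) : P <> P' ->
  rho = pr (boxed P) / pr (boxed P') -> cpat P = cpat P' -> 2^-1 < alpha -> 0 < eps ->
  (limn_esup (fun n : nat =>
      (cond_pr Pr
         [set w | (eps * n%:R `^ alpha <= `| (npat P w)%:R - rho * (npat P' w)%:R |)%R]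
         (size_eq d q n) `^ ((n%:R `^ (2 * alpha - 1))^-1))%:E) < 1)%E.
Proof.
move=> PP' rhoE cc a1 e0.
have rho0 : 0 < rho by rewrite rhoE; exact: rho_gt0.
have a0 : 0 < alpha by apply: lt_trans a1.
have er0 : 0 < eps / rho by exact: divr_gt0.
have [c c0 Hc] := excess_bound hinv hmarkov hfe d2 PP' a0 e0.
rewrite -rhoE in Hc.
have [c' c'0 Hc'] := excess_bound hinv hmarkov hfe d2 (nesym PP') a0 er0.
have m0 : 0 < Num.min c c' by rewrite lt_min c0.
apply: (limn_esup_root_lt1 (c := Num.min c c') (K := 2) _ m0) => [||].
- by rewrite subr_gt0 mulrC -ltr_pdivrMr // mul1r.
- by move=> n; exact: cond_pr_ge0.
near=> n; set y := n%:R `^ alpha; set t := n%:R `^ (2 * alpha - 1).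
have t0 : 0 <= t by exact: powR_ge0.
have mD (D : nat -> nat -> Prop) := measurable_npat_event d2 P P' n D.
set E := size_eq d q n.
apply: cond_pr_le; first by rewrite mulr_ge0 ?expR_ge0.
pose D1 := [set w : config d q | (rho * (npat P' w)%:R + eps * y <= (npat P w)%:R)%R].
pose D2 := [set w : config d q | (pr (boxed P') / pr (boxed P) * (npat P w)%:R + eps / rho * y
  <= (npat P' w)%:R)%R].
have m1 : measurable (D1 `&` E) by exact: (mD (fun a b => (rho * b%:R + eps * y <= a%:R)%R)).
have m2 : measurable (D2 `&` E).
  exact: (mD (fun a b => (pr (boxed P') / pr (boxed P) * a%:R + eps / rho * y <= b%:R)%R)).
have b1 : pr (D1 `&` E) <= expR (- c * t) * pr E.
  have [n' [_ /(_ cc) ->]] : exists n', [/\ n%:R - y <= n'%:R :> R, cpat P = cpat P' -> n' = n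
      & pr (D1 `&` E) <= expR (- c * t) * pr (size_eq d q n')].
    by rewrite /D1 /E /y /t; near: n.
  by [].
have b2 : pr (D2 `&` E) <= expR (- c' * t) * pr E.
  have [n' [_ /(_ (esym cc)) ->]] : exists n', [/\ n%:R - y <= n'%:R :> R, cpat P' = cpat P -> n' = n
      & pr (D2 `&` E) <= expR (- c' * t) * pr (size_eq d q n')].
    by rewrite /D2 /E /y /t; near: n.
  by [].
have le_exp k : Num.min c c' <= k -> expR (- k * t) * pr E <= expR (- Num.min c c' * t) * pr E.
  by move=> h; rewrite ler_wpM2r ?pr_ge0 // ler_expR ler_wpM2r // lerN2.
apply: (@le_trans _ _ (pr (D1 `&` E) + pr (D2 `&` E))); last first.
  rewrite -mulrA mulr_natl mulr2n.
  by apply: lerD; [apply: (le_trans b1)|apply: (le_trans b2)]; apply: le_exp; rewrite ge_min lexx ?orbT.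
apply: (@le_trans _ _ (pr (D1 `&` E `|` D2 `&` E))); last first.
  by rewrite -lee_fin EFinD !fineK ?fin_num_measure //; [exact: measureU2|exact: measurableU].
apply: pr_le; [|exact: measurableU|].
  exact: (mD (fun a b => (eps * y <= `|a%:R - rho * b%:R|)%R)).
move=> w [/= Dw Ew]; move: Dw; rewrite ler_normr => /orP[h|h]; [left|right]; split=> //=.
  by rewrite /D1 /= -lerBrDl.
rewrite /D2 /=.
have -> : pr (boxed P') / pr (boxed P) = rho^-1 by rewrite rhoE invf_div.
rewrite -(ler_pM2l rho0) mulrDr mulrA divff ?lt0r_neq0 // mul1r.
have -> : rho * (eps / rho * y) = eps * y by field; exact: lt0r_neq0.
by move: h; rewrite opprB lerBrDl.
Unshelve. all: by end_near. Qed.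

(** For mu < 1 the exponential tail would make Pr(|C| = n) decay geometrically,
    whereas the stretched tail bounds it below by exp(- O(n^beta)). *)
Lemma stretched_tail_mu1 (mu beta : R) : exponential_tail Pr mu ->
  0 < beta < 1 -> stretched_tail Pr beta -> mu = 1.
Proof.
move=> [/andP[mu0 mu1] hmu _] /andP[b0 b1] [nu [/andP[nu0 nu1] hnu _]].
apply/eqP; rewrite eq_le mu1 /= leNgt; apply/negP => lt1.
have v0 (b : R) : \forall n \near \oo, 0 < n%:R `^ b :> R.
  near=> n; apply: powR_gt0; apply: (lt_le_trans ltr01); near: n; exact: near_ge1.
pose p n := pr (size_eq d q n).
have p0 n : 0 <= p n by exact: pr_ge0.
have lmu : ln mu < 0 by rewrite ln_lt0 // mu0.
have dl : 0 < - ln mu / 2 by rewrite divr_gt0 ?oppr_gt0.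
have H1 := root_cvg_bounds p0 (fun n => powR_ge0 n%:R beta) (v0 beta) nu0 ltr01 hnu.
have v1 : \forall n \near \oo, 0 < n%:R :> R.
  near=> n; apply: (lt_le_trans ltr01); near: n; exact: near_ge1.
have H2 := root_cvg_bounds p0 (fun n => ler0n R n) v1 mu0 dl hmu.
suff : \forall n \near \oo, False by case=> N _ /(_ N (leqnn N)).
near=> n.
have n1 : 1 <= n%:R :> R by near: n; exact: near_ge1.
have n0 : 0 < n%:R :> R by apply: lt_le_trans n1.
have : expR ((ln nu - 1) * n%:R `^ beta) <= p n <= expR ((ln nu + 1) * n%:R `^ beta) by near: n.
have : expR ((ln mu - - ln mu / 2) * n%:R) <= p n <= expR ((ln mu + - ln mu / 2) * n%:R) by near: n.
move=> /andP[_ h1] /andP[h2 _]; have := le_trans h2 h1; rewrite ler_expR.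
have nE : n%:R = n%:R `^ beta * n%:R `^ (1 - beta) :> R.
  by rewrite -{1}[n%:R]powRr1 ?(ltW n0) // -powRD ?(lt0r_neq0 n0) ?implybT // addrC subrK.
have y0 : 0 < n%:R `^ beta :> R by exact: powR_gt0.
rewrite [X in _ <= _ * X]nE [X in _ <= X]mulrA [X in _ <= X]mulrAC ler_pM2r //.
apply/negP; rewrite -ltNge.
have : (2 - ln nu) / (- ln mu / 2) <= n%:R `^ (1 - beta).
  by near: n; apply: powR_near_ge; rewrite subr_gt0.
rewrite ler_pdivrMr //; move: (n%:R `^ (1 - beta)) => z.
rewrite (_ : (ln mu + - ln mu / 2) * z = - (z * (- ln mu / 2))); last by field.
lra.
Unshelve. all: by end_near. Qed.

Lemma stretched_case (P P' : pattern d q r) (beta alpha eps rho : R) : P <> P' ->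
  rho = pr (boxed P) / pr (boxed P') -> 0 < beta < 1 -> stretched_tail Pr beta ->
  2^-1 * (1 + beta) <= alpha -> 0 < eps ->
  (limn_esup (fun n : nat =>
      (cond_pr Pr
         [set w | (rho * (npat P' w)%:R + eps * n%:R `^ alpha <= (npat P w)%:R)%R]
         (size_eq d q n) `^ ((n%:R `^ (2 * alpha - 1))^-1))%:E) < 1)%E.
Proof.
move=> PP' rhoE /andP[b0 b1] [nu [/andP[nu0 nu1] hnu _]] ab e0.
have ab' : beta <= 2 * alpha - 1 by move: ab; clear PP'; lra.
have a0 : 0 < alpha by move: ab b0; clear PP'; lra.
have ta0 : 0 < 2 * alpha - 1 by apply: lt_le_trans ab'.
have [c c0 Hc] := excess_bound hinv hmarkov hfe d2 PP' a0 e0.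
rewrite -rhoE in Hc.
pose p n := pr (size_eq d q n).
have p0 n : 0 <= p n by exact: pr_ge0.
have p1 n : p n <= 1 by apply: pr_le1; exact: measurable_size_eq.
have v0 : \forall n \near \oo, 0 < n%:R `^ beta :> R.
  near=> n; apply: powR_gt0; apply: (lt_le_trans ltr01); near: n; exact: near_ge1.
pose L := - ln nu.
have L0 : 0 < L by rewrite oppr_gt0 ln_lt0 // nu0.
have tail delta : 0 < delta -> \forall n \near \oo,
    expR (- (L + delta) * n%:R `^ beta) <= p n <= expR (- (L - delta) * n%:R `^ beta).
  move=> dl; rewrite (_ : - (L + delta) = ln nu - delta); last by rewrite /L opprD opprK.
  rewrite (_ : - (L - delta) = ln nu + delta); last by rewrite /L opprB opprK addrC.
  exact: root_cvg_bounds p0 (fun n => powR_ge0 n%:R beta) v0 nu0 dl hnu.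
have c20 : 0 < c / 2 by exact: divr_gt0.
apply: (limn_esup_root_lt1 (c := c / 2) (K := 1) ta0 c20).
  by move=> n; exact: cond_pr_ge0.
(* half of the gain of the switches pays for replacing p n' by p n *)
suff key : \forall n \near \oo, forall n', n%:R - n%:R `^ alpha <= n'%:R :> R ->
    p n' <= expR (c / 2 * n%:R `^ (2 * alpha - 1)) * p n.
  near=> n; rewrite mul1r; set t := n%:R `^ (2 * alpha - 1).
  apply: cond_pr_le; first exact: expR_ge0.
  have [n' [hn' _ h]] : exists n', [/\ n%:R - n%:R `^ alpha <= n'%:R :> R, cpat P = cpat P' -> n' = n
      & pr ([set w | (rho * (npat P' w)%:R + eps * n%:R `^ alpha <= (npat P w)%:R)%R]
            `&` size_eq d q n) <= expR (- c * t) * p n'].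
    by rewrite /t; near: n.
  apply: (le_trans h); rewrite (_ : - (c / 2) * t = - c * t + c / 2 * t); last by field.
  rewrite expRD -mulrA ler_wpM2l ?expR_ge0 //; move: n' hn' {h}; rewrite /t; near: n.
  exact: key.
(* above the critical exponent the bound p n' <= 1 is enough *)
have [ab2|ab2] := ltP beta (2 * alpha - 1).
  have T1 := tail 1 ltr01.
  near=> n => n' _; apply: (le_trans (p1 n')).
  have /andP[h _] : expR (- (L + 1) * n%:R `^ beta) <= p n <= expR (- (L - 1) * n%:R `^ beta) by near: n.
  apply: (@le_trans _ _
      (expR (c / 2 * n%:R `^ (2 * alpha - 1)) * expR (- (L + 1) * n%:R `^ beta))); last first.
    by rewrite ler_wpM2l ?expR_ge0.
  have n1 : 1 <= n%:R :> R by near: n; exact: near_ge1.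
  have n0 : 0 < n%:R :> R by apply: lt_le_trans n1.
  rewrite -expRD -[X in X <= _]expR0 ler_expR mulNr subr_ge0.
  rewrite (_ : n%:R `^ (2 * alpha - 1) = n%:R `^ beta * n%:R `^ (2 * alpha - 1 - beta)); last first.
    by rewrite -powRD ?(lt0r_neq0 n0) ?implybT //; congr (_ `^ _); ring.
  rewrite mulrCA [leRHS]mulrC ler_wpM2r ?powR_ge0 // -ler_pdivrMl //.
  by near: n; apply: powR_near_ge; rewrite subr_gt0.
have eab : 2 * alpha - 1 = beta by apply/eqP; rewrite eq_le ab2.
have a1 : alpha < 1 by move: eab b1; clear PP'; lra.
(* delta makes (L + delta) - (L - delta) (1 - delta) <= c / 2 *)
pose delta := Num.min 2^-1 (Num.min L (c / 2 / (2 + L))).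
have dl0 : 0 < delta by rewrite !lt_min L0 invr_gt0 ltr0n /= divr_gt0 // addr_gt0.
have dl1 : delta <= 2^-1 by rewrite ge_min lexx.
have dlL : delta <= L by rewrite !ge_min lexx !orbT.
have dlc : (2 + L) * delta <= c / 2.
  by rewrite mulrC -ler_pdivlMr ?addr_gt0 // !ge_min lexx !orbT.
have [N _ HN] := tail delta dl0.
near=> n => n' hn'; rewrite eab.
have n1 : 1 <= n%:R :> R by near: n; exact: near_ge1.
have n0 : 0 < n%:R :> R by apply: lt_le_trans n1.
have na : n%:R `^ alpha <= delta * n%:R.
  have nE : n%:R = n%:R `^ alpha * n%:R `^ (1 - alpha) :> R.
    by rewrite -{1}[n%:R]powRr1 ?(ltW n0) // -powRD ?(lt0r_neq0 n0) ?implybT // addrC subrK.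
  rewrite [X in _ <= _ * X]nE mulrCA ler_peMr ?powR_ge0 // -ler_pdivrMl // mulr1.
  by near: n; apply: powR_near_ge; rewrite subr_gt0.
have n'n : (1 - delta) * n%:R <= n'%:R.
  by apply: le_trans hn'; rewrite mulrBl mul1r lerD2l lerN2.
have Nn' : (N <= n')%N.
  rewrite -(ler_nat R); apply: le_trans n'n; rewrite mulrC -ler_pdivrMr; last first.
    by move: dl1; clear PP'; lra.
  by near: n; exact: nbhs_infty_ger.
have Nn : (N <= n)%N by near: n; exists N.
have /andP[_ up] := HN n' Nn'; have /andP[lo _] := HN n Nn.
apply: (le_trans up).
apply: (@le_trans _ _
    (expR (c / 2 * n%:R `^ beta) * expR (- (L + delta) * n%:R `^ beta))); last first.
  by rewrite ler_wpM2l ?expR_ge0.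
rewrite -expRD ler_expR -mulrDl !mulNr -[leRHS]opprK lerN2 -mulNr.
have d1 : 0 < 1 - delta <= 1 by move: dl0 dl1; clear PP'; lra.
have n'b : (1 - delta) * n%:R `^ beta <= n'%:R `^ beta.
  apply: (@le_trans _ _ (((1 - delta) * n%:R) `^ beta)); last first.
    apply: ge0_ler_powR; rewrite ?nnegrE ?ler0n ?(ltW b0) // mulr_ge0 ?ler0n //.
    by case/andP: d1 => /ltW.
  have d0 : 0 <= 1 - delta by case/andP: d1 => /ltW.
  rewrite powRM ?ler0n // ler_wpM2r ?powR_ge0 //.
  by apply: ger1_powR => //; exact: ltW.
apply: (@le_trans _ _ ((L - delta) * ((1 - delta) * n%:R `^ beta))); last first.
  by rewrite ler_wpM2l // subr_ge0.
rewrite mulrA ler_wpM2r ?powR_ge0 //.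
have : 0 <= delta * delta by rewrite mulr_ge0 // ltW.
move: dlc; rewrite mulrDl mulrBl !mulrBr !mulr1; clear PP'; lra.
Unshelve. all: by end_near. Qed.

End Final.

Theorem theorem1p9 (R : realType) (d q : nat) (hd : (2 <= d)%N) (hq : (2 <= q)%N)
    (Pr : probability (config d q) R) (mu : R)
    (hinv : translation_invariant Pr)
    (hmarkov : boundary_markov (spin1 q) Pr)
    (hfe : finite_energy Pr)
    (htail : exponential_tail Pr mu)
    (r : nat) (hr : (1 <= r)%N)
    (P P' : pattern d q r) (hPP' : P <> P') :
  (cpat P = cpat P' ->
   forall alpha : R, 2^-1 < alpha -> forall eps : R, 0 < eps ->
   (limn_esup (fun n : nat =>
      (cond_pr Pr
         [set w | (eps * n%:R `^ alpha <=
           `| (npat P w)%:R - gamma_ratio Pr mu P P' * (npat P' w)%:R |)%R]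
         (size_eq d q n)
       `^ ((n%:R `^ (2 * alpha - 1))^-1))%:E) < 1)%E) /\
  (forall beta : R, 0 < beta < 1 -> stretched_tail Pr beta ->
   forall alpha : R, 2^-1 * (1 + beta) <= alpha ->
   forall eps : R, 0 < eps ->
   (limn_esup (fun n : nat =>
      (cond_pr Pr
         [set w | (gamma_ratio Pr mu P P' * (npat P' w)%:R
           + eps * n%:R `^ alpha <= (npat P w)%:R)%R]
         (size_eq d q n)
       `^ ((n%:R `^ (2 * alpha - 1))^-1))%:E) < 1)%E).
Proof.
have [/andP[mu0 _] _ _] := htail; split.
- move=> cc alpha a1 eps e0.
  by apply: equal_size_case => //; exact: gamma_ratio_equal.
- move=> beta hb hst alpha ab eps e0.
  rewrite (stretched_tail_mu1 htail hb hst).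
  by apply: (stretched_case hinv hmarkov hfe hd hPP' _ hb hst) => //; exact: gamma_ratio1.
Qed.
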